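(* Let $p>2$ and $k>3$ be distinct primes. Let $q=p^r>3$ for some $r\ge1$. Then there exist matrices $M_a,M_b,M_c\in \mathrm{GL}_k(\mathbb{F}_q)$ and symmetric matrices $M_a',M_b',M_c'\in\mathrm{GL}_k(\mathbb{F}_q)$ such that \[\Phi_{M_a,M_b,M_c}\colon \mathfrak{U}^+_{A}(\mathbb{F}_q)\to \mathrm{SL}_{4k}(\mathbb{F}_q)\quad\text{and}\quad \Phi_{M_a',M_b',M_c'}\colon \mathfrak{U}^+_{A}(\mathbb{F}_q)\to \mathrm{Sp}_{4k}(\mathbb{F}_q)\] are surjective group homomorphisms, where $A$ is the generalised Cartan matrix of type $\mathrm{HB}_2^{(2)}$.
   Context: The generalised Cartan matrix of type $\mathrm{HB}_2^{(2)}$, with index set $I=\{a,b,c\}$ in this order, is \[A=\begin{pmatrix} 2&-1&-2 \\ -1&2&-2 \\ -1&-1&2 \end{pmatrix}.\] For a field $\mathbb{K}$, $\mathfrak{G}_A(\mathbb{K})$ is the minimal Kac–Moody group of type $A$ (constructive Tits functor of simply connected type evaluated at $\mathbb{K}$), with root subgroups $\mathfrak{U}_\alpha(\mathbb{K})=\{x_\alpha(\lambda)\}\cong(\mathbb{K},+)$ for real roots $\alpha$, and $\mathfrak{U}^+_A(\mathbb{K}):=\langle \mathfrak{U}_\alpha(\mathbb{K}) : \alpha \text{ a positive real root}\rangle$. For $|\mathbb{K}|\ge 4$ it is generated by the simple root elements $x_i(\lambda)$, $i\in\{a,b,c\}$, $\lambda\in\mathbb{K}$. Concrete description: let $\mathfrak{n}^+$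 be the complex Lie algebra with generators $e_i$ ($i\in I$) and relations $\mathrm{ad}(e_i)^{1-A_{ij}}(e_j)=0$ ($i\ne j$). Let $\mathcal{U}^+_{\mathbb{Z}}$ be the subring of its universal enveloping algebra generated by the $e_i^{(s)}=e_i^s/s!$, graded by total degree as $\bigoplus_{n\ge0}\mathcal{U}^+_{n,\mathbb{Z}}$, and put $\widehat{\mathcal{U}}^+_{\mathbb{K}}=\prod_{n\ge 0}(\mathcal{U}^+_{n,\mathbb{Z}}\otimes\mathbb{K})$. For $|\mathbb{K}|\ge4$, $\mathfrak{U}^+_A(\mathbb{K})$ is identified with the subgroup of $(\widehat{\mathcal{U}}^+_{\mathbb{K}})^\times$ generated by $x_i(\lambda)=\sum_{s\ge0}e_i^{(s)}\otimes\lambda^s$. For $M_a,M_b,M_c\in\mathrm{Mat}_{n\times n}(\mathbb{K})$, $\Phi_{M_a,M_b,M_c}\colon \mathfrak{U}^+_A(\mathbb{K})\to\mathrm{SL}_{4n}(\mathbb{K})$ is the group homomorphism determined by $x_i(\lambda)\mapsto V_i(\lambda)$, $i\in\{a,b,c\}$, where, in $n\times n$ blocks ($1$ denotes the $n\times n$ identity matrix), \[ V_a(\lambda) = \begin{pmatrix} 1&0&0&\lambda M_a \\ 0&1&\lambda M_a&0 \\ 0&0&1&0 \\ 0&0&0&1 \end{pmatrix},\quad V_b(\lambda) = \begin{pmatrix} 1&0&0&0 \\ \lambda M_b&1&0&0 \\ 0&0&1&-\lambda M_b \\ 0&0&0&1 \end{pmatrix},\quad V_c(\lambda) = \begin{pmatrix}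 1&0&0&0 \\ 0&1&0&0 \\ 0&0&1&0 \\ 0&\lambda M_c&0&1 \end{pmatrix}. \] $\mathrm{Sp}_{2m}(\mathbb{K})=\{X\in\mathrm{GL}_{2m}(\mathbb{K}): X^t\Omega_mX=\Omega_m\}$ with $\Omega_m=\begin{pmatrix} 0 & -I_m \\ I_m & 0 \end{pmatrix}$, where $I_m$ is the $m\times m$ identity matrix. *)

(* Defs.v *)
From HB Require Import structures.
From mathcomp Require Import all_boot all_order all_algebra.
From mathcomp Require Import boolp.
From mathcomp Require Import reals complex.

Set Implicit Arguments.
Unset Strict Implicit.
Unset Printing Implicit Defensive.
Import GRing.Theory Num.Theory.

Local Open Scope ring_scope.
Local Open Scope quotient_scope.

Section Quotient.
Variables (T : Type) (E : T -> T -> Prop).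
Hypothesis HE : RelationClasses.Equivalence E.

Definition quot_rel : rel {classic T} := fun x y => `[< E x y >].

Let quot_refl : reflexive quot_rel.
Proof. by move=> x; apply/asboolP; case: HE. Qed.

Let quot_sym : symmetric quot_rel.
Proof.
by case: HE => _ s _ x y; apply/asboolP/asboolP; apply: s.
Qed.

Let quot_trans : transitive quot_rel.
Proof.
case: HE => _ _ t y x z /asboolP xy /asboolP yz; apply/asboolP.
exact: t xy yz.
Qed.

Definition quot_equiv := EquivRel quot_rel quot_refl quot_sym quot_trans.

Definition quot : Type := {eq_quot quot_equiv}.

HB.instance Definition _ := Choice.on quot.

Definition cls (x : T) : quot := \pi_{eq_quot quot_equiv} (x : {classic T}).

Definition rep (q : quot) : T := repr (q : {eq_quot quot_equiv}).

Lemma repK q : cls (rep q) = q.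
Proof. exact: reprK. Qed.

Lemma clsP x y : cls x = cls y <-> E x y.
Proof.
split=> [/eqmodP /= /asboolP //|xy].
by apply/eqmodP/asboolP.
Qed.

Lemma rep_cls x : E (rep (cls x)) x.
Proof. by apply/clsP; rewrite repK. Qed.

Lemma quotW (P : quot -> Prop) : (forall x, P (cls x)) -> forall q, P q.
Proof. by move=> Px q; rewrite -(repK q). Qed.

End Quotient.

HB.mixin Record Lmodule_isLie (K : fieldType) L of GRing.Lmodule K L := {
  lie : L -> L -> L;
  lieDl : forall x y z, lie (x + y) z = lie x z + lie y z;
  lieDr : forall x y z, lie x (y + z) = lie x y + lie x z;
  lieZl : forall (a : K) x y, lie (a *: x) y = a *: lie x y;
  lieZr : forall (a : K) x y, lie x (a *: y) = a *: lie x y;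
  liexx : forall x, lie x x = 0;
  lie_jacobi : forall x y z,
    lie x (lie y z) + lie y (lie z x) + lie z (lie x y) = 0
}.

#[short(type="lieType")]
HB.structure Definition Lie (K : fieldType) :=
  {L of GRing.Lmodule K L & Lmodule_isLie K L}.

Section LiePresentation.
Variables (K : fieldType) (X : Type).

Inductive lie_term : Type :=
| LGen of X
| LZero
| LAdd of lie_term & lie_term
| LScale of K & lie_term
| LBr of lie_term & lie_term.

(* The relators are the terms satisfying S: each of them is made equal to 0. *)
Variable S : lie_term -> Prop.

Inductive lie_eq : lie_term -> lie_term -> Prop :=
| LE_refl x : lie_eq x x
| LE_sym x y : lie_eq x y -> lie_eq y x
| LE_trans x y z : lie_eq x y -> lie_eq y z -> lie_eq x z
| LE_add x x' y y' :
    lie_eq x x' -> lie_eq y y' -> lie_eq (LAdd x y) (LAdd x' y')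
| LE_scale a x x' : lie_eq x x' -> lie_eq (LScale a x) (LScale a x')
| LE_br x x' y y' :
    lie_eq x x' -> lie_eq y y' -> lie_eq (LBr x y) (LBr x' y')
| LE_addA x y z : lie_eq (LAdd x (LAdd y z)) (LAdd (LAdd x y) z)
| LE_addC x y : lie_eq (LAdd x y) (LAdd y x)
| LE_add0 x : lie_eq (LAdd LZero x) x
| LE_addN x : lie_eq (LAdd (LScale (-1) x) x) LZero
| LE_scaleA a b x : lie_eq (LScale a (LScale b x)) (LScale (a * b) x)
| LE_scale1 x : lie_eq (LScale 1 x) x
| LE_scaleDr a x y :
    lie_eq (LScale a (LAdd x y)) (LAdd (LScale a x) (LScale a y))
| LE_scaleDl a b x :
    lie_eq (LScale (a + b) x) (LAdd (LScale a x) (LScale b x))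
| LE_brDl x y z : lie_eq (LBr (LAdd x y) z) (LAdd (LBr x z) (LBr y z))
| LE_brDr x y z : lie_eq (LBr x (LAdd y z)) (LAdd (LBr x y) (LBr x z))
| LE_brZl a x y : lie_eq (LBr (LScale a x) y) (LScale a (LBr x y))
| LE_brZr a x y : lie_eq (LBr x (LScale a y)) (LScale a (LBr x y))
| LE_brxx x : lie_eq (LBr x x) LZero
| LE_jacobi x y z :
    lie_eq (LAdd (LAdd (LBr x (LBr y z)) (LBr y (LBr z x))) (LBr z (LBr x y)))
           LZero
| LE_rel x : S x -> lie_eq x LZero.

Lemma lie_equiv : RelationClasses.Equivalence lie_eq.
Proof. by split; [exact: LE_refl | exact: LE_sym | exact: LE_trans]. Qed.

Definition lie_pres : Type := quot lie_equiv.

HB.instance Definition _ := Choice.on lie_pres.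

Local Notation c := (cls lie_equiv).

Definition lp_gen (x : X) : lie_pres := c (LGen x).
Definition lp_zero : lie_pres := c LZero.
Definition lp_add (x y : lie_pres) : lie_pres := c (LAdd (rep x) (rep y)).
Definition lp_scale (a : K) (x : lie_pres) : lie_pres := c (LScale a (rep x)).
Definition lp_br (x y : lie_pres) : lie_pres := c (LBr (rep x) (rep y)).

Lemma cls_LAdd x y : c (LAdd x y) = lp_add (c x) (c y).
Proof. by apply/clsP; apply: LE_add; apply: LE_sym; apply: rep_cls. Qed.

Lemma cls_LScale a x : c (LScale a x) = lp_scale a (c x).
Proof. by apply/clsP; apply: LE_scale; apply: LE_sym; apply: rep_cls. Qed.

Lemma cls_LBr x y : c (LBr x y) = lp_br (c x) (c y).
Proof. by apply/clsP; apply: LE_br; apply: LE_sym; apply: rep_cls. Qed.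

Let clsE := (cls_LAdd, cls_LScale, cls_LBr).

Let lp_addA : associative lp_add.
Proof.
elim/quotW=> x; elim/quotW=> y; elim/quotW=> z.
by rewrite -!clsE; apply/clsP/LE_addA.
Qed.
Let lp_addC : commutative lp_add.
Proof. by elim/quotW=> x; elim/quotW=> y; rewrite -!clsE; apply/clsP/LE_addC. Qed.
Let lp_add0 : left_id lp_zero lp_add.
Proof. by elim/quotW=> x; rewrite -!clsE; apply/clsP/LE_add0. Qed.
Let lp_addN : left_inverse lp_zero (lp_scale (-1)) lp_add.
Proof. by elim/quotW=> x; rewrite -!clsE; apply/clsP/LE_addN. Qed.

HB.instance Definition _ :=
  GRing.isZmodule.Build lie_pres lp_addA lp_addC lp_add0 lp_addN.

Let lp_scaleA a b x : lp_scale a (lp_scale b x) = lp_scale (a * b) x.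
Proof. by elim/quotW: x => x; rewrite -!clsE; apply/clsP/LE_scaleA. Qed.
Let lp_scale1 : left_id 1 lp_scale.
Proof. by elim/quotW=> x; rewrite -!clsE; apply/clsP/LE_scale1. Qed.
Let lp_scaleDr : right_distributive lp_scale +%R.
Proof.
move=> a; elim/quotW=> x; elim/quotW=> y.
by rewrite /GRing.add /= -!clsE; apply/clsP/LE_scaleDr.
Qed.
Let lp_scaleDl x : {morph lp_scale^~ x : a b / a + b}.
Proof.
move=> a b; elim/quotW: x => x.
by rewrite [RHS]/GRing.add /= -!clsE; apply/clsP/LE_scaleDl.
Qed.

HB.instance Definition _ := GRing.Zmodule_isLmodule.Build K lie_pres
  lp_scaleA lp_scale1 lp_scaleDr lp_scaleDl.

Let lp_brDl x y z : lp_br (x + y) z = lp_br x z + lp_br y z.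
Proof.
elim/quotW: x => x; elim/quotW: y => y; elim/quotW: z => z.
by rewrite /GRing.add /= -!clsE; apply/clsP/LE_brDl.
Qed.
Let lp_brDr x y z : lp_br x (y + z) = lp_br x y + lp_br x z.
Proof.
elim/quotW: x => x; elim/quotW: y => y; elim/quotW: z => z.
by rewrite /GRing.add /= -!clsE; apply/clsP/LE_brDr.
Qed.
Let lp_brZl (a : K) x y : lp_br (a *: x) y = a *: lp_br x y.
Proof.
elim/quotW: x => x; elim/quotW: y => y.
by rewrite /GRing.scale /= -!clsE; apply/clsP/LE_brZl.
Qed.
Let lp_brZr (a : K) x y : lp_br x (a *: y) = a *: lp_br x y.
Proof.
elim/quotW: x => x; elim/quotW: y => y.
by rewrite /GRing.scale /= -!clsE; apply/clsP/LE_brZr.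
Qed.
Let lp_brxx x : lp_br x x = 0.
Proof. by elim/quotW: x => x; rewrite -!clsE; apply/clsP/LE_brxx. Qed.
Let lp_jacobi x y z :
  lp_br x (lp_br y z) + lp_br y (lp_br z x) + lp_br z (lp_br x y) = 0.
Proof.
elim/quotW: x => x; elim/quotW: y => y; elim/quotW: z => z.
by rewrite /GRing.add /= -!clsE; apply/clsP/LE_jacobi.
Qed.

HB.instance Definition _ := Lmodule_isLie.Build K lie_pres
  lp_brDl lp_brDr lp_brZl lp_brZr lp_brxx lp_jacobi.

End LiePresentation.

Arguments LGen {K X}.
Arguments LZero {K X}.

Section Envelope.
Variables (K : fieldType) (L : lieType K).

Inductive env_term : Type :=
| EIn of L
| EZero
| EOne
| EAdd of env_term & env_term
| EScale of K & env_term
| EMul of env_term & env_term.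

Inductive env_eq : env_term -> env_term -> Prop :=
| EE_refl x : env_eq x x
| EE_sym x y : env_eq x y -> env_eq y x
| EE_trans x y z : env_eq x y -> env_eq y z -> env_eq x z
| EE_add x x' y y' :
    env_eq x x' -> env_eq y y' -> env_eq (EAdd x y) (EAdd x' y')
| EE_scale a x x' : env_eq x x' -> env_eq (EScale a x) (EScale a x')
| EE_mul x x' y y' :
    env_eq x x' -> env_eq y y' -> env_eq (EMul x y) (EMul x' y')
| EE_addA x y z : env_eq (EAdd x (EAdd y z)) (EAdd (EAdd x y) z)
| EE_addC x y : env_eq (EAdd x y) (EAdd y x)
| EE_add0 x : env_eq (EAdd EZero x) x
| EE_addN x : env_eq (EAdd (EScale (-1) x) x) EZero
| EE_scaleA a b x : env_eq (EScale a (EScale b x)) (EScale (a * b) x)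
| EE_scale1 x : env_eq (EScale 1 x) x
| EE_scaleDr a x y :
    env_eq (EScale a (EAdd x y)) (EAdd (EScale a x) (EScale a y))
| EE_scaleDl a b x :
    env_eq (EScale (a + b) x) (EAdd (EScale a x) (EScale b x))
| EE_mulA x y z : env_eq (EMul x (EMul y z)) (EMul (EMul x y) z)
| EE_mul1l x : env_eq (EMul EOne x) x
| EE_mul1r x : env_eq (EMul x EOne) x
| EE_mulDl x y z : env_eq (EMul (EAdd x y) z) (EAdd (EMul x z) (EMul y z))
| EE_mulDr x y z : env_eq (EMul x (EAdd y z)) (EAdd (EMul x y) (EMul x z))
| EE_scaleAl a x y : env_eq (EScale a (EMul x y)) (EMul (EScale a x) y)
| EE_scaleAr a x y : env_eq (EScale a (EMul x y)) (EMul x (EScale a y))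
| EE_inD u v : env_eq (EIn (u + v)) (EAdd (EIn u) (EIn v))
| EE_inZ a u : env_eq (EIn (a *: u)) (EScale a (EIn u))
| EE_in_lie u v :
    env_eq (EIn (lie u v))
           (EAdd (EMul (EIn u) (EIn v)) (EScale (-1) (EMul (EIn v) (EIn u)))).

Lemma env_equiv : RelationClasses.Equivalence env_eq.
Proof. by split; [exact: EE_refl | exact: EE_sym | exact: EE_trans]. Qed.

Definition envelope : Type := quot env_equiv.

HB.instance Definition _ := Choice.on envelope.

Local Notation c := (cls env_equiv).

Definition env_in (x : L) : envelope := c (EIn x).
Definition env_zero : envelope := c EZero.
Definition env_one : envelope := c EOne.
Definition env_add (x y : envelope) : envelope := c (EAdd (rep x) (rep y)).
Definition env_scale (a : K) (x : envelope) : envelope := c (EScale a (rep x)).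
Definition env_mul (x y : envelope) : envelope := c (EMul (rep x) (rep y)).

Lemma cls_EAdd x y : c (EAdd x y) = env_add (c x) (c y).
Proof. by apply/clsP; apply: EE_add; apply: EE_sym; apply: rep_cls. Qed.

Lemma cls_EScale a x : c (EScale a x) = env_scale a (c x).
Proof. by apply/clsP; apply: EE_scale; apply: EE_sym; apply: rep_cls. Qed.

Lemma cls_EMul x y : c (EMul x y) = env_mul (c x) (c y).
Proof. by apply/clsP; apply: EE_mul; apply: EE_sym; apply: rep_cls. Qed.

Let clsE := (cls_EAdd, cls_EScale, cls_EMul).

Let env_addA : associative env_add.
Proof.
elim/quotW=> x; elim/quotW=> y; elim/quotW=> z.
by rewrite -!clsE; apply/clsP/EE_addA.
Qed.
Let env_addC : commutative env_add.
Proof. by elim/quotW=> x; elim/quotW=> y; rewrite -!clsE; apply/clsP/EE_addC. Qed.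
Let env_add0 : left_id env_zero env_add.
Proof. by elim/quotW=> x; rewrite -!clsE; apply/clsP/EE_add0. Qed.
Let env_addN : left_inverse env_zero (env_scale (-1)) env_add.
Proof. by elim/quotW=> x; rewrite -!clsE; apply/clsP/EE_addN. Qed.

HB.instance Definition _ :=
  GRing.isZmodule.Build envelope env_addA env_addC env_add0 env_addN.

Let env_mulA : associative env_mul.
Proof.
elim/quotW=> x; elim/quotW=> y; elim/quotW=> z.
by rewrite -!clsE; apply/clsP/EE_mulA.
Qed.
Let env_mul1l : left_id env_one env_mul.
Proof. by elim/quotW=> x; rewrite -!clsE; apply/clsP/EE_mul1l. Qed.
Let env_mul1r : right_id env_one env_mul.
Proof. by elim/quotW=> x; rewrite -!clsE; apply/clsP/EE_mul1r. Qed.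
Let env_mulDl : left_distributive env_mul +%R.
Proof.
elim/quotW=> x; elim/quotW=> y; elim/quotW=> z.
by rewrite /GRing.add /= -!clsE; apply/clsP/EE_mulDl.
Qed.
Let env_mulDr : right_distributive env_mul +%R.
Proof.
elim/quotW=> x; elim/quotW=> y; elim/quotW=> z.
by rewrite /GRing.add /= -!clsE; apply/clsP/EE_mulDr.
Qed.

Fixpoint env_aug (x : env_term) : K :=
  match x with
  | EIn _ | EZero => 0
  | EOne => 1
  | EAdd x y => env_aug x + env_aug y
  | EScale a x => a * env_aug x
  | EMul x y => env_aug x * env_aug y
  end.

Let env_augP x y : env_eq x y -> env_aug x = env_aug y.
Proof.
elim=> //=.
- by move=> *; congruence.
- by move=> x1 x2 y1 y2 _ -> _ ->.
- by move=> a x1 x2 _ ->.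
- by move=> x1 x2 y1 y2 _ -> _ ->.
- by move=> *; rewrite addrA.
- by move=> *; rewrite addrC.
- by move=> *; rewrite add0r.
- by move=> *; rewrite mulN1r addNr.
- by move=> *; rewrite mulrA.
- by move=> *; rewrite mul1r.
- by move=> *; rewrite mulrDr.
- by move=> *; rewrite mulrDl.
- by move=> *; rewrite mulrA.
- by move=> *; rewrite mul1r.
- by move=> *; rewrite mulr1.
- by move=> *; rewrite mulrDl.
- by move=> *; rewrite mulrDr.
- by move=> *; rewrite mulrA.
- by move=> *; rewrite mulrCA.
- by move=> *; rewrite addr0.
- by move=> *; rewrite mulr0.
- by move=> *; rewrite mulr0 mulr0 addr0.
Qed.

Let env_1n0 : env_one != 0.
Proof.
by apply/eqP => /clsP/env_augP /= /eqP; rewrite oner_eq0.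
Qed.

HB.instance Definition _ := GRing.Zmodule_isNzRing.Build envelope
  env_mulA env_mul1l env_mul1r env_mulDl env_mulDr env_1n0.

Let env_scaleA a b x : env_scale a (env_scale b x) = env_scale (a * b) x.
Proof. by elim/quotW: x => x; rewrite -!clsE; apply/clsP/EE_scaleA. Qed.
Let env_scale1 : left_id 1 env_scale.
Proof. by elim/quotW=> x; rewrite -!clsE; apply/clsP/EE_scale1. Qed.
Let env_scaleDr : right_distributive env_scale +%R.
Proof.
move=> a; elim/quotW=> x; elim/quotW=> y.
by rewrite /GRing.add /= -!clsE; apply/clsP/EE_scaleDr.
Qed.
Let env_scaleDl x : {morph env_scale^~ x : a b / a + b}.
Proof.
move=> a b; elim/quotW: x => x.
by rewrite [RHS]/GRing.add /= -!clsE; apply/clsP/EE_scaleDl.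
Qed.

HB.instance Definition _ := GRing.Zmodule_isLmodule.Build K envelope
  env_scaleA env_scale1 env_scaleDr env_scaleDl.

Let env_scaleAl (a : K) (x y : envelope) : a *: (x * y) = (a *: x) * y.
Proof.
elim/quotW: x => x; elim/quotW: y => y.
by rewrite /GRing.scale /GRing.mul /= -!clsE; apply/clsP/EE_scaleAl.
Qed.
Let env_scaleAr (a : K) (x y : envelope) : a *: (x * y) = x * (a *: y).
Proof.
elim/quotW: x => x; elim/quotW: y => y.
by rewrite /GRing.scale /GRing.mul /= -!clsE; apply/clsP/EE_scaleAr.
Qed.

HB.instance Definition _ :=
  GRing.Lmodule_isLalgebra.Build K envelope env_scaleAl.
HB.instance Definition _ :=
  GRing.Lalgebra_isAlgebra.Build K envelope env_scaleAr.

End Envelope.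

Section Tensor.
Variables A B : zmodType.

Inductive tens_term : Type :=
| TPure of A & B
| TZero
| TAdd of tens_term & tens_term
| TOpp of tens_term.

Inductive tens_eq : tens_term -> tens_term -> Prop :=
| TE_refl x : tens_eq x x
| TE_sym x y : tens_eq x y -> tens_eq y x
| TE_trans x y z : tens_eq x y -> tens_eq y z -> tens_eq x z
| TE_add x x' y y' :
    tens_eq x x' -> tens_eq y y' -> tens_eq (TAdd x y) (TAdd x' y')
| TE_opp x x' : tens_eq x x' -> tens_eq (TOpp x) (TOpp x')
| TE_addA x y z : tens_eq (TAdd x (TAdd y z)) (TAdd (TAdd x y) z)
| TE_addC x y : tens_eq (TAdd x y) (TAdd y x)
| TE_add0 x : tens_eq (TAdd TZero x) x
| TE_addN x : tens_eq (TAdd (TOpp x) x) TZero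
| TE_pureDl a a' b :
    tens_eq (TPure (a + a') b) (TAdd (TPure a b) (TPure a' b))
| TE_pureDr a b b' :
    tens_eq (TPure a (b + b')) (TAdd (TPure a b) (TPure a b')).

Lemma tens_equiv : RelationClasses.Equivalence tens_eq.
Proof. by split; [exact: TE_refl | exact: TE_sym | exact: TE_trans]. Qed.

(* A (x) B over the integers. *)
Definition tensor : Type := quot tens_equiv.

HB.instance Definition _ := Choice.on tensor.

Local Notation c := (cls tens_equiv).

Definition tpure (a : A) (b : B) : tensor := c (TPure a b).
Definition tens_zero : tensor := c TZero.
Definition tens_add (x y : tensor) : tensor := c (TAdd (rep x) (rep y)).
Definition tens_opp (x : tensor) : tensor := c (TOpp (rep x)).

Lemma cls_TAdd x y : c (TAdd x y) = tens_add (c x) (c y).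
Proof. by apply/clsP; apply: TE_add; apply: TE_sym; apply: rep_cls. Qed.

Lemma cls_TOpp x : c (TOpp x) = tens_opp (c x).
Proof. by apply/clsP; apply: TE_opp; apply: TE_sym; apply: rep_cls. Qed.

Let clsE := (cls_TAdd, cls_TOpp).

Let tens_addA : associative tens_add.
Proof.
elim/quotW=> x; elim/quotW=> y; elim/quotW=> z.
by rewrite -!clsE; apply/clsP/TE_addA.
Qed.
Let tens_addC : commutative tens_add.
Proof. by elim/quotW=> x; elim/quotW=> y; rewrite -!clsE; apply/clsP/TE_addC. Qed.
Let tens_add0 : left_id tens_zero tens_add.
Proof. by elim/quotW=> x; rewrite -!clsE; apply/clsP/TE_add0. Qed.
Let tens_addN : left_inverse tens_zero tens_opp tens_add.
Proof. by elim/quotW=> x; rewrite -!clsE; apply/clsP/TE_addN. Qed.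

HB.instance Definition _ :=
  GRing.isZmodule.Build tensor tens_addA tens_addC tens_add0 tens_addN.

Lemma tpureDl a a' b : tpure (a + a') b = tpure a b + tpure a' b.
Proof. by rewrite /GRing.add /= -cls_TAdd; apply/clsP/TE_pureDl. Qed.

Lemma tpureDr a b b' : tpure a (b + b') = tpure a b + tpure a b'.
Proof. by rewrite /GRing.add /= -cls_TAdd; apply/clsP/TE_pureDr. Qed.

Lemma tpure0l b : tpure 0 b = 0.
Proof. by apply: (addrI (tpure 0 b)); rewrite -tpureDl !addr0. Qed.

Lemma tpure0r a : tpure a 0 = 0.
Proof. by apply: (addrI (tpure a 0)); rewrite -tpureDr !addr0. Qed.

Lemma tpureNl a b : tpure (- a) b = - tpure a b.
Proof.
by apply: (addIr (tpure a b)); rewrite -tpureDl !addNr tpure0l.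
Qed.

Lemma tensor_ind (P : tensor -> Prop) :
    (forall a b, P (tpure a b)) -> P 0 ->
    (forall x y, P x -> P y -> P (x + y)) -> (forall x, P x -> P (- x)) ->
  forall x, P x.
Proof.
move=> Pp P0 PD PN; elim/quotW; elim=> [a b||x Px y Py|x Px] //.
- exact: Pp.
- by rewrite cls_TAdd; apply: PD.
- by rewrite cls_TOpp; apply: PN.
Qed.

Section Lift.
Variables (Z : zmodType) (f : A -> B -> Z).

Fixpoint tens_eval (x : tens_term) : Z :=
  match x with
  | TPure a b => f a b
  | TZero => 0
  | TAdd x y => tens_eval x + tens_eval y
  | TOpp x => - tens_eval x
  end.

Definition tens_lift (x : tensor) : Z := tens_eval (rep x).

Hypothesis fDl : forall a a' b, f (a + a') b = f a b + f a' b.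
Hypothesis fDr : forall a b b', f a (b + b') = f a b + f a b'.

Let tens_evalP x y : tens_eq x y -> tens_eval x = tens_eval y.
Proof.
elim=> //=.
- by move=> *; congruence.
- by move=> x1 x2 y1 y2 _ -> _ ->.
- by move=> x1 x2 _ ->.
- by move=> *; rewrite addrA.
- by move=> *; rewrite addrC.
- by move=> *; rewrite add0r.
- by move=> *; rewrite addNr.
Qed.

Lemma tens_lift_cls x : tens_lift (c x) = tens_eval x.
Proof. by apply: tens_evalP; apply: (rep_cls tens_equiv). Qed.

Lemma tens_lift_pure a b : tens_lift (tpure a b) = f a b.
Proof. exact: tens_lift_cls. Qed.

Lemma tens_lift0 : tens_lift 0 = 0.
Proof. exact: tens_lift_cls. Qed.

Lemma tens_liftD x y : tens_lift (x + y) = tens_lift x + tens_lift y.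
Proof.
elim/quotW: x => x; elim/quotW: y => y.
by rewrite {1}/GRing.add /= -cls_TAdd !tens_lift_cls.
Qed.

Lemma tens_liftN x : tens_lift (- x) = - tens_lift x.
Proof.
elim/quotW: x => x.
by rewrite {1}/GRing.opp /= -cls_TOpp !tens_lift_cls.
Qed.

End Lift.
End Tensor.

Section TensorRing.
Variables A B : pzRingType.

Definition tens_lmul (a : A) (b : B) : tensor A B -> tensor A B :=
  tens_lift (fun a' b' => tpure (a * a') (b * b')).

Definition tens_mul (x y : tensor A B) : tensor A B :=
  tens_lift (fun a b => tens_lmul a b y) x.

Let lmul_l (a : A) (b : B) a1 a2 b' :
  tpure (a * (a1 + a2)) (b * b')
    = tpure (a * a1) (b * b') + tpure (a * a2) (b * b').
Proof. by rewrite mulrDr tpureDl. Qed.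

Let lmul_r (a : A) (b : B) a' b1 b2 :
  tpure (a * a') (b * (b1 + b2))
    = tpure (a * a') (b * b1) + tpure (a * a') (b * b2).
Proof. by rewrite mulrDr tpureDr. Qed.

Let lmul_pure a b a' b' :
  tens_lmul a b (tpure a' b') = tpure (a * a') (b * b').
Proof. by apply: tens_lift_pure; [exact: lmul_l | exact: lmul_r]. Qed.
Let lmul0 a b : tens_lmul a b 0 = 0.
Proof. by apply: tens_lift0; [exact: lmul_l | exact: lmul_r]. Qed.
Let lmulD a b x y : tens_lmul a b (x + y) = tens_lmul a b x + tens_lmul a b y.
Proof. by apply: tens_liftD; [exact: lmul_l | exact: lmul_r]. Qed.
Let lmulN a b x : tens_lmul a b (- x) = - tens_lmul a b x.
Proof. by apply: tens_liftN; [exact: lmul_l | exact: lmul_r]. Qed.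

Let mul_l y a1 a2 b :
  tens_lmul (a1 + a2) b y = tens_lmul a1 b y + tens_lmul a2 b y.
Proof.
elim/tensor_ind: y => [a' b'||x y IHx IHy|x IHx].
- by rewrite !lmul_pure mulrDl tpureDl.
- by rewrite !lmul0 addr0.
- by rewrite !lmulD IHx IHy addrACA.
- by rewrite !lmulN IHx opprD.
Qed.

Let mul_r y a b1 b2 :
  tens_lmul a (b1 + b2) y = tens_lmul a b1 y + tens_lmul a b2 y.
Proof.
elim/tensor_ind: y => [a' b'||x y IHx IHy|x IHx].
- by rewrite !lmul_pure mulrDl tpureDr.
- by rewrite !lmul0 addr0.
- by rewrite !lmulD IHx IHy addrACA.
- by rewrite !lmulN IHx opprD.
Qed.

Let mul_lmul a b y : tens_mul (tpure a b) y = tens_lmul a b y.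
Proof. by apply: tens_lift_pure; [exact: mul_l | exact: mul_r]. Qed.
Let mul0t y : tens_mul 0 y = 0.
Proof. by apply: tens_lift0; [exact: mul_l | exact: mul_r]. Qed.
Let mulNt x y : tens_mul (- x) y = - tens_mul x y.
Proof. by apply: tens_liftN; [exact: mul_l | exact: mul_r]. Qed.

Let tens_mulDl : left_distributive tens_mul +%R.
Proof.
by move=> x y z; apply: tens_liftD; [exact: mul_l | exact: mul_r].
Qed.

Let tens_mulDr : right_distributive tens_mul +%R.
Proof.
move=> x y z; elim/tensor_ind: x => [a b||x x' IHx IHx'|x IHx].
- by rewrite !mul_lmul lmulD.
- by rewrite !mul0t addr0.
- by rewrite !tens_mulDl IHx IHx' addrACA.
- by rewrite !mulNt IHx opprD.
Qed.

Let tens_mulA : associative tens_mul.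
Proof.
move=> x y z; elim/tensor_ind: x => [a b||x x' IHx IHx'|x IHx].
- elim/tensor_ind: y => [a' b'||y y' IHy IHy'|y IHy].
  + rewrite !mul_lmul lmul_pure mul_lmul.
    elim/tensor_ind: z => [a'' b''||z z' IHz IHz'|z IHz].
    * by rewrite !lmul_pure !mulrA.
    * by rewrite !lmul0.
    * by rewrite !lmulD IHz IHz'.
    * by rewrite !lmulN IHz.
  + by rewrite !mul_lmul mul0t lmul0 mul0t.
  + by rewrite tens_mulDl !tens_mulDr tens_mulDl IHy IHy'.
  + by move: IHy; rewrite !mul_lmul mulNt !lmulN mulNt => ->.
- by rewrite !mul0t.
- by rewrite !tens_mulDl IHx IHx'.
- by rewrite !mulNt IHx.
Qed.

Let tens_mul1l : left_id (tpure 1 1) tens_mul.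
Proof.
move=> x; rewrite mul_lmul; elim/tensor_ind: x => [a b||x y IHx IHy|x IHx].
- by rewrite lmul_pure !mul1r.
- by rewrite lmul0.
- by rewrite lmulD IHx IHy.
- by rewrite lmulN IHx.
Qed.

Let tens_mul1r : right_id (tpure 1 1) tens_mul.
Proof.
elim/tensor_ind=> [a b||x y IHx IHy|x IHx].
- by rewrite mul_lmul lmul_pure !mulr1.
- by rewrite mul0t.
- by rewrite tens_mulDl IHx IHy.
- by rewrite mulNt IHx.
Qed.

HB.instance Definition _ := GRing.Zmodule_isPzRing.Build (tensor A B)
  tens_mulA tens_mul1l tens_mul1r tens_mulDl tens_mulDr.

Lemma tpureM a b a' b' :
  tpure a b * tpure a' b' = tpure (a * a') (b * b') :> tensor A B.
Proof. by rewrite [LHS]mul_lmul lmul_pure. Qed.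

Lemma tpure1 : tpure 1 1 = 1 :> tensor A B.
Proof. by []. Qed.

End TensorRing.

Section KacMoodyNilpotent.
Variables (C : numFieldType) (n : nat) (A : 'M[int]_n).

(* The relators ad(e_i)^(1 - A_ij)(e_j); the absolute value only converts to
   nat, as 1 - A_ij > 0 for i != j in a generalised Cartan matrix. *)
Definition serre (t : lie_term C 'I_n) : Prop :=
  exists i j : 'I_n,
    i != j /\ t = iter `|1 - A i j|%N (LBr (LGen i)) (LGen j).

Definition nplus : lieType C := lie_pres serre.

Definition Uenv : algType C := envelope nplus.

Definition egen (i : 'I_n) : Uenv := env_in (lp_gen serre i : nplus).

Definition divpow (i : 'I_n) (s : nat) : Uenv := (s`!%:R : C)^-1 *: egen i ^+ s.

Inductive in_UZ : Uenv -> Prop :=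
| UZ_divpow i s : in_UZ (divpow i s)
| UZ_one : in_UZ 1
| UZ_sub x y : in_UZ x -> in_UZ y -> in_UZ (x - y)
| UZ_mul x y : in_UZ x -> in_UZ y -> in_UZ (x * y).

Definition UZ_pred : pred Uenv := fun x => `[< in_UZ x >].

Lemma UZ_subring_closed : subring_closed UZ_pred.
Proof.
split=> [|x y /asboolP xU /asboolP yU|x y /asboolP xU /asboolP yU];
  apply/asboolP; [exact: UZ_one | exact: UZ_sub | exact: UZ_mul].
Qed.

Record UZ : Type := MkUZ { UZval : Uenv; _ : UZ_pred UZval }.

HB.instance Definition _ := [isSub for UZval].
HB.instance Definition _ := [Choice of UZ by <:].
HB.instance Definition _ :=
  GRing.SubChoice_isSubNzRing.Build Uenv UZ_pred UZ UZ_subring_closed.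

Definition UZ_divp (i : 'I_n) (s : nat) : UZ :=
  MkUZ (introT (asboolP _) (UZ_divpow i s)).

(* Total degree d: the C-span of the words of length d in the e_i. *)
Inductive homog (d : nat) : Uenv -> Prop :=
| homog_word (w : d.-tuple 'I_n) : homog d (\prod_(i <- w) egen i)
| homog0 : homog d 0
| homogD x y : homog d x -> homog d y -> homog d (x + y)
| homogZ a x : homog d x -> homog d (a *: x).

Lemma homog1 : homog 0 1.
Proof. by have := homog_word [tuple of [::]]; rewrite big_nil. Qed.

Lemma homogM d d' x y : homog d x -> homog d' y -> homog (d + d') (x * y).
Proof.
elim=> {x} [w||x x' _ IHx _ IHx'|a x _ IHx] Hy.
- elim: Hy => {y} [w'||y y' _ IHy _ IHy'|a y _ IHy].
  + by rewrite -big_cat /=; apply: (homog_word [tuple of w ++ w']).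
  + by rewrite mulr0; apply: homog0.
  + by rewrite mulrDr; apply: homogD.
  + by rewrite -scalerAr; apply: homogZ.
- by rewrite mul0r; apply: homog0.
- by rewrite mulrDl; apply: homogD; [apply: IHx | apply: IHx'].
- by rewrite -scalerAl; apply: homogZ; apply: IHx.
Qed.

Lemma homog_divpow i s : homog s (divpow i s).
Proof.
apply: homogZ; have := homog_word [tuple of nseq s i].
by rewrite /= big_nseq -[iter _ _ _]Monoid.iteropE.
Qed.

Section Completion.
Variable K : fieldType.

Definition UK : pzRingType := tensor UZ K.

(* Since UZ is the direct sum of its subgroups UZ_d = UZ :&: homog d, the
   group UZ_d (x) K is the following subgroup of UZ (x) K. *)
Inductive UK_homog (d : nat) : UK -> Prop :=
| UKh_pure (u : UZ) (a : K) : homog d (\val u) -> UK_homog d (tpure u a)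
| UKh0 : UK_homog d 0
| UKhD x y : UK_homog d x -> UK_homog d y -> UK_homog d (x + y)
| UKhN x : UK_homog d x -> UK_homog d (- x).

Lemma UKh1 : UK_homog 0 1.
Proof. by apply: (@UKh_pure 0 1 1); apply: homog1. Qed.

Lemma UKhM d d' x y :
  UK_homog d x -> UK_homog d' y -> UK_homog (d + d') (x * y).
Proof.
elim=> {x} [u a Hu||x x' _ IHx _ IHx'|x _ IHx] Hy.
- elim: Hy => {y} [v b Hv||y y' _ IHy _ IHy'|y _ IHy].
  + by rewrite [_ * _]tpureM; apply: UKh_pure; apply: homogM.
  + by rewrite mulr0; apply: UKh0.
  + by rewrite mulrDr; apply: UKhD.
  + by rewrite mulrN; apply: UKhN.
- by rewrite mul0r; apply: UKh0.
- by rewrite mulrDl; apply: UKhD; [apply: IHx | apply: IHx'].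
- by rewrite mulNr; apply: UKhN; apply: IHx.
Qed.

Lemma UKh_sum d (I : Type) (r : seq I) (P : pred I) (f : I -> UK) :
  (forall i, P i -> UK_homog d (f i)) -> UK_homog d (\sum_(i <- r | P i) f i).
Proof.
by move=> Hf; elim/big_ind: _ => //; [exact: UKh0 | exact: UKhD].
Qed.

(* The product over d of the UZ_d (x) K; Uhat_mul is the Cauchy product. *)
Record Uhat : Type := MkUhat {
  coefU :> nat -> UK;
  coefU_homog : forall d, UK_homog d (coefU d)
}.

HB.instance Definition _ := gen_eqMixin Uhat.
HB.instance Definition _ := gen_choiceMixin Uhat.

Lemma UhatP (x y : Uhat) : (forall d, x d = y d) -> x = y.
Proof.
case: x y => [x Hx] [y Hy] /= xy; have {}xy : x = y by apply: funext.
by move: Hx Hy; rewrite xy => Hx Hy; congr MkUhat; apply: Prop_irrelevance.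
Qed.

Definition Uhat_zero : Uhat := @MkUhat (fun=> 0) (fun d => UKh0 d).

Definition Uhat_opp (x : Uhat) : Uhat :=
  @MkUhat (fun d => - x d) (fun d => UKhN (coefU_homog x d)).

Definition Uhat_add (x y : Uhat) : Uhat :=
  @MkUhat (fun d => x d + y d)
    (fun d => UKhD (coefU_homog x d) (coefU_homog y d)).

Lemma Uhat_one_homog d : UK_homog d (if d == 0%N then 1 else 0).
Proof. by case: eqP => [->|_]; [exact: UKh1 | exact: UKh0]. Qed.

Definition Uhat_one : Uhat := MkUhat Uhat_one_homog.

Lemma Uhat_mul_homog (x y : Uhat) d :
  UK_homog d (\sum_(i < d.+1) x i * y (d - i)%N).
Proof.
apply: UKh_sum => i _; rewrite -[X in UK_homog X](subnKC (leq_ord i)).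
by apply: UKhM; apply: coefU_homog.
Qed.

Definition Uhat_mul (x y : Uhat) : Uhat := MkUhat (Uhat_mul_homog x y).

Let Uhat_addA : associative Uhat_add.
Proof. by move=> x y z; apply: UhatP => d /=; rewrite addrA. Qed.
Let Uhat_addC : commutative Uhat_add.
Proof. by move=> x y; apply: UhatP => d /=; rewrite addrC. Qed.
Let Uhat_add0 : left_id Uhat_zero Uhat_add.
Proof. by move=> x; apply: UhatP => d /=; rewrite add0r. Qed.
Let Uhat_addN : left_inverse Uhat_zero Uhat_opp Uhat_add.
Proof. by move=> x; apply: UhatP => d /=; rewrite addNr. Qed.

Let Uhat_mul_rev (x y : Uhat) d :
  Uhat_mul x y d = \sum_(i < d.+1) x (d - i)%N * y i.
Proof.
rewrite /= (reindex_inj rev_ord_inj) /=.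
by apply: eq_bigr => i _; rewrite subSS subKn // -ltnS.
Qed.

Let Uhat_mulA : associative Uhat_mul.
Proof.
move=> x y z; apply: UhatP => d; rewrite [RHS]Uhat_mul_rev.
pose co3 j i := x j * (y (d - j - i)%N * z i).
transitivity (\sum_(j < d.+1) \sum_(i < d.+1 | (i <= d - j)%N) co3 j i).
  rewrite /=; apply: eq_bigr => j _.
  rewrite [\sum_(i < _) y i * _](Uhat_mul_rev y z) big_distrr /=.
  by rewrite (big_ord_narrow_leq (leq_subr _ _)).
rewrite (exchange_big_dep predT) //=; apply: eq_bigr => i _.
transitivity (\sum_(j < d.+1 | (j <= d - i)%N) co3 j i).
  apply: eq_bigl => j; rewrite -ltnS -(ltnS j) -!subSn ?leq_ord //.
  by rewrite -subn_gt0 -(subn_gt0 j) -!subnDA addnC.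
rewrite (big_ord_narrow_leq (leq_subr _ _)) /= big_distrl /=.
by apply: eq_bigr => j _; rewrite /co3 -!subnDA addnC mulrA.
Qed.

Let Uhat_mul1l : left_id Uhat_one Uhat_mul.
Proof.
move=> x; apply: UhatP => d /=; rewrite big_ord_recl /= mul1r subn0.
by rewrite big1 ?addr0 // => i _; rewrite mul0r.
Qed.

Let Uhat_mul1r : right_id Uhat_one Uhat_mul.
Proof.
move=> x; apply: UhatP => d; rewrite Uhat_mul_rev big_ord_recl /= mulr1 subn0.
by rewrite big1 ?addr0 // => i _; rewrite mulr0.
Qed.

Let Uhat_mulDl : left_distributive Uhat_mul Uhat_add.
Proof.
move=> x y z; apply: UhatP => d /=; rewrite -big_split /=.
by apply: eq_bigr => i _; rewrite mulrDl.
Qed.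

Let Uhat_mulDr : right_distributive Uhat_mul Uhat_add.
Proof.
move=> x y z; apply: UhatP => d /=; rewrite -big_split /=.
by apply: eq_bigr => i _; rewrite mulrDr.
Qed.

HB.instance Definition _ := GRing.isPzRing.Build Uhat
  Uhat_addA Uhat_addC Uhat_add0 Uhat_addN
  Uhat_mulA Uhat_mul1l Uhat_mul1r Uhat_mulDl Uhat_mulDr.

Lemma xexp_homog i (l : K) d : UK_homog d (tpure (UZ_divp i d) (l ^+ d)).
Proof. exact/UKh_pure/homog_divpow. Qed.

(* x_i(l) = \sum_d e_i^(d) (x) l^d. *)
Definition xexp (i : 'I_n) (l : K) : Uhat := MkUhat (xexp_homog i l).

Lemma divpowM i s t : divpow i s * divpow i t = divpow i (s + t) *+ 'C(s + t, s).
Proof.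
rewrite /divpow -scalerAl -scalerAr -exprD scalerA -scaler_nat scalerA.
congr (_ *: _); rewrite -(bin_fact (leq_addr t s)) addKn !natrM.
have bnz : ('C(s + t, s)%:R : C) != 0.
  by rewrite pnatr_eq0 -lt0n bin_gt0 leq_addr.
by rewrite !invfM mulVKf.
Qed.

Lemma xexpD i l m : xexp i l * xexp i m = xexp i (l + m).
Proof.
apply: UhatP => d /=; rewrite addrC exprDn.
transitivity (\sum_(s < d.+1) tpure (UZ_divp i d *+ 'C(d, s))
                                    (l ^+ s * m ^+ (d - s))).
  apply: eq_bigr => s _; rewrite [LHS]tpureM; congr tpure.
  apply: val_inj; rewrite /= -[RHS]/(\val _) raddfMn /= divpowM subnKC //.
  exact: leq_ord.
elim/big_rec2: _ => [|s x y _ ->]; first by rewrite tpure0r.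
rewrite tpureDr [m ^+ _ * _]mulrC; congr (_ + _).
elim: 'C(d, s) => [|k IH]; first by rewrite !mulr0n tpure0l tpure0r.
by rewrite !mulrS tpureDl tpureDr IH.
Qed.

Lemma xexp0 i : xexp i 0 = 1.
Proof.
apply: UhatP => -[|d] /=; last by rewrite expr0n /= tpure0r.
rewrite expr0 -[RHS]tpure1; congr tpure; apply: val_inj => /=.
by rewrite /divpow fact0 invr1 scale1r expr0.
Qed.

Lemma xexpV i l : (xexp i l * xexp i (- l) == 1) && (xexp i (- l) * xexp i l == 1).
Proof. by rewrite !xexpD addrN addNr xexp0 !eqxx. Qed.

End Completion.
End KacMoodyNilpotent.

Section UnitGroup.
Variable R : pzRingType.

Record units : Type := MkUnits {
  units_pair : R * R;
  _ : (units_pair.1 * units_pair.2 == 1) && (units_pair.2 * units_pair.1 == 1)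
}.

HB.instance Definition _ := [isSub for units_pair].
HB.instance Definition _ := [Choice of units by <:].

Coercion uval (u : units) : R := (units_pair u).1.

Lemma units_inj (u v : units) : u = v :> R -> u = v.
Proof.
case: u v => [[x x'] Hx] [[y y'] Hy]; rewrite /uval /= => xy.
apply: val_inj => /=.
have /= /andP[_ /eqP x'x] := Hx; have /= /andP[/eqP yy' _] := Hy.
by rewrite -[x']mulr1 -yy' -xy mulrA x'x mul1r.
Qed.

Lemma units_one_subproof : ((1 : R) * 1 == 1) && ((1 : R) * 1 == 1).
Proof. by rewrite mulr1 eqxx. Qed.
Definition units_one : units := @MkUnits (1, 1) units_one_subproof.

Lemma units_inv_subproof (u : units) :
  ((units_pair u).2 * (units_pair u).1 == 1)
    && ((units_pair u).1 * (units_pair u).2 == 1).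
Proof. by rewrite andbC; case: u. Qed.
Definition units_inv (u : units) : units :=
  @MkUnits ((units_pair u).2, (units_pair u).1) (units_inv_subproof u).

Lemma units_mul_subproof (u v : units) :
  let a := (units_pair u).1 * (units_pair v).1 in
  let b := (units_pair v).2 * (units_pair u).2 in
  (a * b == 1) && (b * a == 1).
Proof.
case: u v => [[x x'] Hx] [[y y'] Hy] /=.
have /= /andP[/eqP xx' /eqP x'x] := Hx.
have /= /andP[/eqP yy' /eqP y'y] := Hy.
by rewrite -mulrA (mulrA y) yy' mul1r xx' -mulrA (mulrA x') x'x mul1r y'y eqxx.
Qed.
Definition units_mul (u v : units) : units :=
  @MkUnits ((units_pair u).1 * (units_pair v).1,
            (units_pair v).2 * (units_pair u).2) (units_mul_subproof u v).

Let units_mulA : associative units_mul.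
Proof. by move=> x y z; apply: units_inj; rewrite /uval /= mulrA. Qed.
Let units_mul1g : left_id units_one units_mul.
Proof. by move=> x; apply: units_inj; rewrite /uval /= mul1r. Qed.
Let units_mulg1 : right_id units_one units_mul.
Proof. by move=> x; apply: units_inj; rewrite /uval /= mulr1. Qed.
Let units_mulVg : left_inverse units_one units_inv units_mul.
Proof.
by case=> [[x y] H]; apply: units_inj; have /= /andP[_ /eqP] := H.
Qed.
Let units_mulgV : right_inverse units_one units_inv units_mul.
Proof.
by case=> [[x y] H]; apply: units_inj; have /= /andP[/eqP] := H.
Qed.

HB.instance Definition _ := isGroup.Build units
  units_mulA units_mul1g units_mulg1 units_mulVg units_mulgV.

End UnitGroup.

Section GeneratedSubgroup.
Variables (G : groupType) (S : G -> Prop).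

Inductive in_gen : G -> Prop :=
| gen_incl x : S x -> in_gen x
| gen_one : in_gen 1%g
| gen_div x y : in_gen x -> in_gen y -> in_gen (x / y)%g.

Definition gen_pred : pred G := fun x => `[< in_gen x >].

Lemma gen_group_closed : group_closed gen_pred.
Proof.
split=> [|x y /asboolP xS /asboolP yS]; apply/asboolP; first exact: gen_one.
exact: gen_div.
Qed.

Record gen_group : Type := MkGen { gen_val : G; _ : gen_pred gen_val }.

HB.instance Definition _ := [isSub for gen_val].
HB.instance Definition _ := [Choice of gen_group by <:].
HB.instance Definition _ :=
  SubChoice_isSubGroup.Build G gen_pred gen_group gen_group_closed.

End GeneratedSubgroup.

Section UPlus.
Variables (R : realType) (n : nat) (A : 'M[int]_n) (K : fieldType).

Definition xunit (i : 'I_n) (l : K) : units (Uhat R[i] A K) :=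
  @MkUnits (Uhat R[i] A K) (xexp _ A i l, xexp _ A i (- l)) (xexpV _ A i l).

(* For |K| >= 4 this is the subgroup generated by all positive real root
   subgroups of the minimal Kac-Moody group of type A over K.  The complex
   numbers are R[i]; they only serve to define the integral form UZ. *)
Definition Uplus : groupType :=
  gen_group (fun u : units (Uhat R[i] A K) => exists i l, u = xunit i l).

Lemma xroot_subproof i l :
  gen_pred (fun u : units (Uhat R[i] A K) => exists i l, u = xunit i l)
    (xunit i l).
Proof. by apply/asboolP/gen_incl; exists i, l. Qed.

Definition xroot (i : 'I_n) (l : K) : Uplus := MkGen (xroot_subproof i l).

End UPlus.

Section SpecialLinear.
Variables (K : fieldType) (n : nat).

Record SL : Type := MkSL { SLval :> 'M[K]_n; _ : \det SLval == 1 }.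

HB.instance Definition _ := [isSub for SLval].
HB.instance Definition _ := [Choice of SL by <:].

Definition SL_one : SL := MkSL (introT eqP (det1 K n)).

Lemma SL_inv_subproof (X : SL) : \det (invmx X) == 1.
Proof. by case: X => X /= /eqP dX; rewrite det_inv dX invr1. Qed.
Definition SL_inv (X : SL) : SL := MkSL (SL_inv_subproof X).

Lemma SL_mul_subproof (X Y : SL) : \det (X *m Y) == 1.
Proof.
by case: X Y => X /= /eqP dX [Y /= /eqP dY]; rewrite det_mulmx dX dY mulr1.
Qed.
Definition SL_mul (X Y : SL) : SL := MkSL (SL_mul_subproof X Y).

Let SL_unit (X : SL) : (X : 'M_n) \in unitmx.
Proof. by case: X => X /= /eqP dX; rewrite unitmxE dX unitr1. Qed.

Let SL_mulA : associative SL_mul.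
Proof. by move=> X Y Z; apply: val_inj; rewrite /= mulmxA. Qed.
Let SL_mul1g : left_id SL_one SL_mul.
Proof. by move=> X; apply: val_inj; rewrite /= mul1mx. Qed.
Let SL_mulg1 : right_id SL_one SL_mul.
Proof. by move=> X; apply: val_inj; rewrite /= mulmx1. Qed.
Let SL_mulVg : left_inverse SL_one SL_inv SL_mul.
Proof. by move=> X; apply: val_inj; rewrite /= mulVmx ?SL_unit. Qed.
Let SL_mulgV : right_inverse SL_one SL_inv SL_mul.
Proof. by move=> X; apply: val_inj; rewrite /= mulmxV ?SL_unit. Qed.

HB.instance Definition _ := isGroup.Build SL
  SL_mulA SL_mul1g SL_mulg1 SL_mulVg SL_mulgV.

End SpecialLinear.

Section Symplectic.
Variables (K : fieldType) (m : nat).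

Definition Omega : 'M[K]_(m + m) := block_mx 0 (- 1%:M) 1%:M 0.

(* Sp_(2m), acting on column vectors of length m + m. *)
Record Sp : Type := MkSp {
  Spval :> 'M[K]_(m + m);
  _ : (Spval \in unitmx) && (Spval^T *m Omega *m Spval == Omega)
}.

HB.instance Definition _ := [isSub for Spval].
HB.instance Definition _ := [Choice of Sp by <:].

Lemma Sp_one_subproof :
  ((1%:M : 'M[K]_(m + m)) \in unitmx) && (1%:M^T *m Omega *m 1%:M == Omega).
Proof. by rewrite unitmx1 trmx1 mul1mx mulmx1 eqxx. Qed.
Definition Sp_one : Sp := MkSp Sp_one_subproof.

Lemma Sp_inv_subproof (X : Sp) :
  (invmx X \in unitmx) && ((invmx X)^T *m Omega *m invmx X == Omega).
Proof.
case: X => X /= /andP[Xu /eqP HX]; rewrite unitmx_inv Xu /=; apply/eqP.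
rewrite -{1}HX trmx_inv !mulmxA mulVmx ?unitmx_tr // mul1mx.
by rewrite -mulmxA mulmxV // mulmx1.
Qed.
Definition Sp_inv (X : Sp) : Sp := MkSp (Sp_inv_subproof X).

Lemma Sp_mul_subproof (X Y : Sp) :
  (X *m Y \in unitmx) && ((X *m Y)^T *m Omega *m (X *m Y) == Omega).
Proof.
case: X Y => X /= /andP[Xu /eqP HX] [Y /= /andP[Yu /eqP HY]].
rewrite unitmx_mul Xu Yu trmx_mul /= -!mulmxA (mulmxA Omega).
by rewrite (mulmxA X^T) (mulmxA X^T) HX mulmxA HY.
Qed.
Definition Sp_mul (X Y : Sp) : Sp := MkSp (Sp_mul_subproof X Y).

Let Sp_unit (X : Sp) : (X : 'M_(m + m)) \in unitmx.
Proof. by case: X => X /= /andP[]. Qed.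

Let Sp_mulA : associative Sp_mul.
Proof. by move=> X Y Z; apply: val_inj; rewrite /= mulmxA. Qed.
Let Sp_mul1g : left_id Sp_one Sp_mul.
Proof. by move=> X; apply: val_inj; rewrite /= mul1mx. Qed.
Let Sp_mulg1 : right_id Sp_one Sp_mul.
Proof. by move=> X; apply: val_inj; rewrite /= mulmx1. Qed.
Let Sp_mulVg : left_inverse Sp_one Sp_inv Sp_mul.
Proof. by move=> X; apply: val_inj; rewrite /= mulVmx ?Sp_unit. Qed.
Let Sp_mulgV : right_inverse Sp_one Sp_inv Sp_mul.
Proof. by move=> X; apply: val_inj; rewrite /= mulmxV ?Sp_unit. Qed.

HB.instance Definition _ := isGroup.Build Sp
  Sp_mulA Sp_mul1g Sp_mulg1 Sp_mulVg Sp_mulgV.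

End Symplectic.

Definition ia : 'I_3 := @Ordinal 3 0 isT.
Definition ib : 'I_3 := @Ordinal 3 1 isT.
Definition ic : 'I_3 := @Ordinal 3 2 isT.

Definition HB22 : 'M[int]_3 :=
  \matrix_(i, j) nth 0 (nth [::] [:: [::  2; -1; -2];
                                     [:: -1;  2; -2];
                                     [:: -1; -1;  2]] i) j.

Section Phi.
Variables (R : realType) (K : fieldType) (n : nat).

Definition block4 (a11 a12 a13 a14 a21 a22 a23 a24
                   a31 a32 a33 a34 a41 a42 a43 a44 : 'M[K]_n) :
    'M[K]_((n + n) + (n + n)) :=
  block_mx (block_mx a11 a12 a21 a22) (block_mx a13 a14 a23 a24)
           (block_mx a31 a32 a41 a42) (block_mx a33 a34 a43 a44).

Local Notation "1" := (1%:M : 'M[K]_n).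

Definition Va (M : 'M[K]_n) (l : K) := block4
  1 0 0        (l *: M)
  0 1 (l *: M) 0
  0 0 1        0
  0 0 0        1.

Definition Vb (M : 'M[K]_n) (l : K) := block4
  1        0 0 0
  (l *: M) 1 0 0
  0        0 1 (- (l *: M))
  0        0 0 1.

Definition Vc (M : 'M[K]_n) (l : K) := block4
  1 0        0 0
  0 1        0 0
  0 0        1 0
  0 (l *: M) 0 1.

(* f : Uplus R HB22 K -> G is the homomorphism Phi_(Ma, Mb, Mc), where the matrix
   group G is embedded by v into the square matrices of size 4n. *)
Definition is_Phi (Ma Mb Mc : 'M[K]_n) (G : groupType)
    (v : G -> 'M[K]_((n + n) + (n + n)))
    (f : {multiplicative Uplus R HB22 K -> G}) : Prop :=
  forall l, [/\ v (f (xroot R HB22 ia l)) = Va Ma l,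
                v (f (xroot R HB22 ib l)) = Vb Mb l &
                v (f (xroot R HB22 ic l)) = Vc Mc l].

End Phi.

(* Main.v *)
Require Import Defs.
From HB Require Import structures.
From mathcomp Require Import all_boot all_order all_fingroup all_algebra.
From mathcomp Require Import all_field ring zify boolp reals.

Set Implicit Arguments.
Unset Strict Implicit.
Unset Printing Implicit Defensive.
Import GRing.Theory.

Local Open Scope ring_scope.

(** Existence of the homomorphism.  Let N_a, N_b, N_c be the 4k x 4k matrices
    V_i(1) - 1.  Whatever the blocks M_a, M_b, M_c over a commutative ring, the
    N_i have square zero and satisfy the Serre relations.  Taking integer
    blocks, the enveloping algebra acts on complex column vectors, its integral
    form acts by integer matrices, and one may reduce to the finite field.  The
    completed algebra does not act, since the N_i are not simultaneously
    nilpotent; but it maps to matrices of power series by e_i |-> t N_i, the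
    group generated by the x_i(l) lands in matrices of polynomials in t, and
    these can be evaluated at t = 1 (Uplus_hom).

    Surjectivity.  V_a, V_b, V_c belong to roots a, b, c of C_2 with a + b + c = 0,
    a and b short and c long.  A root vector for a short root consists of two
    blocks X, X', which are transposes of each other (up to sign) in the
    symplectic group and are unrelated in the special linear group.  Take
    M_c = 1.  Commutators show that the long root - c carries the matrices W + W',
    W' W and W W', where W = M_a M_b and W' = M_b M_a, and that the root space of a
    is stable under (X, X') |-> (X Y, Y X') for each Y carried by - c
    (short_a_absorb).  So what is obtained is governed by the algebra of pairs
    generated by three pairs (Y, Y).  Let N be the shift matrix and W = 1 + N.
    If M_a, M_b are symmetric with W' = 1 + N^T, then the idempotent 1 - N^T N
    and the path matrix N + N^T generate all pairs (X, X^T).  If W' = 1 + N^T +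
    e with e a suitable matrix unit off the two diagonals, then all pairs are
    generated (pair_algebra).  A boolean sym selects one of the two choices,
    which are treated together.

    From the root a, further commutators reach all short and all long roots, so
    the image contains the unipotent block matrices with arbitrary, respectively
    symmetric, off-diagonal block (upper_all, lower_all); these generate SL_4k
    and Sp_4k (SL_block_generated, Sp_block_generated). *)

(** * The homomorphism attached to integral square-zero matrices *)

(** Integer matrices of square zero that satisfy the Serre relations define a
    complex representation of the enveloping algebra.  In it the divided powers
    beyond the first act by zero, although they involve denominators; hence the
    integral form acts by integer matrices, which reduce to any field K. *)
Section Representation.
Variables (C : numFieldType) (n : nat) (A : 'M[int]_n) (m : nat).

Definition mx_br (S : comNzRingType) (X Y : 'M[S]_m) : 'M[S]_m :=
  X *m Y - Y *m X.

Variable N : 'I_n -> 'M[int]_m.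
Hypothesis N_sq0 : forall i, N i *m N i = 0.
Hypothesis N_serre : forall i j, i != j ->
  iter `|1 - A i j|%N (mx_br (N i)) (N j) = 0.

Local Notation toC := (map_mx (intr : int -> C)).

Fixpoint lie_eval (t : lie_term C 'I_n) : 'M[C]_m :=
  match t with
  | LGen i => toC (N i)
  | LZero => 0
  | LAdd x y => lie_eval x + lie_eval y
  | LScale a x => a *: lie_eval x
  | LBr x y => mx_br (lie_eval x) (lie_eval y)
  end.

Lemma lie_eval_br p X Y :
  lie_eval (iter p (LBr X) Y) = iter p (mx_br (lie_eval X)) (lie_eval Y).
Proof. by elim: p => //= p ->. Qed.

Lemma map_iter_br p X Y :
  iter p (mx_br (toC X)) (toC Y) = toC (iter p (mx_br X) Y).
Proof. by elim: p => //= p ->; rewrite /mx_br map_mxB !map_mxM. Qed.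

Lemma mx_jacobi (X Y Z : 'M[C]_m) :
  mx_br X (mx_br Y Z) + mx_br Y (mx_br Z X) + mx_br Z (mx_br X Y) = 0.
Proof.
rewrite /mx_br !mulmxBr !mulmxBl !mulmxA.
by apply/matrixP => i j; rewrite !mxE; ring.
Qed.

Lemma lie_evalP x y : lie_eq (serre A) x y -> lie_eval x = lie_eval y.
Proof.
elim=> {x y} //=.
- by move=> x1 x2 x3 _ -> _ ->.
- by move=> x1 x2 y1 y2 _ -> _ ->.
- by move=> a x1 x2 _ ->.
- by move=> x1 x2 y1 y2 _ -> _ ->.
- by move=> *; rewrite addrA.
- by move=> *; rewrite addrC.
- by move=> *; rewrite add0r.
- by move=> *; rewrite scaleN1r addNr.
- by move=> *; rewrite scalerA.
- by move=> *; rewrite scale1r.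
- by move=> *; rewrite scalerDr.
- by move=> *; rewrite scalerDl.
- by move=> *; rewrite /mx_br mulmxDl mulmxDr opprD addrACA.
- by move=> *; rewrite /mx_br mulmxDl mulmxDr opprD addrACA.
- by move=> *; rewrite /mx_br -scalemxAl -scalemxAr scalerBr.
- by move=> *; rewrite /mx_br -scalemxAl -scalemxAr scalerBr.
- by move=> *; rewrite /mx_br subrr.
- by move=> *; apply: mx_jacobi.
- move=> t [i [j [ij ->]]].
  by rewrite lie_eval_br /= map_iter_br N_serre // map_mx0.
Qed.

Definition nplus_eval (x : nplus C A) : 'M[C]_m := lie_eval (rep x).

Lemma nplus_eval_cls t : nplus_eval (cls (lie_equiv (serre A)) t) = lie_eval t.
Proof. by apply: lie_evalP; apply: (rep_cls (lie_equiv (serre A))). Qed.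

Fixpoint env_eval (t : env_term (nplus C A)) : 'M[C]_m :=
  match t with
  | EIn x => nplus_eval x
  | EZero => 0
  | EOne => 1%:M
  | EAdd x y => env_eval x + env_eval y
  | EScale a x => a *: env_eval x
  | EMul x y => env_eval x *m env_eval y
  end.

Lemma env_evalP x y : env_eq x y -> env_eval x = env_eval y.
Proof.
elim=> {x y} //=.
- by move=> x1 x2 x3 _ -> _ ->.
- by move=> x1 x2 y1 y2 _ -> _ ->.
- by move=> a x1 x2 _ ->.
- by move=> x1 x2 y1 y2 _ -> _ ->.
- by move=> *; rewrite addrA.
- by move=> *; rewrite addrC.
- by move=> *; rewrite add0r.
- by move=> *; rewrite scaleN1r addNr.
- by move=> *; rewrite scalerA.
- by move=> *; rewrite scale1r.
- by move=> *; rewrite scalerDr.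
- by move=> *; rewrite scalerDl.
- by move=> *; rewrite mulmxA.
- by move=> *; rewrite mul1mx.
- by move=> *; rewrite mulmx1.
- by move=> *; rewrite mulmxDl.
- by move=> *; rewrite mulmxDr.
- by move=> *; rewrite scalemxAl.
- by move=> *; rewrite scalemxAr.
- elim/quotW=> u; elim/quotW=> v.
  by rewrite /GRing.add /= -cls_LAdd !nplus_eval_cls.
- move=> a; elim/quotW=> u.
  by rewrite /GRing.scale /= -cls_LScale !nplus_eval_cls.
- elim/quotW=> u; elim/quotW=> v.
  by rewrite /lie /= -cls_LBr !nplus_eval_cls scaleN1r.
Qed.

Definition Uenv_eval (x : Uenv C A) : 'M[C]_m := env_eval (rep x).

Local Notation c := (cls (env_equiv (nplus C A))).

Lemma Uenv_eval_cls t : Uenv_eval (c t) = env_eval t.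
Proof. by apply: env_evalP; apply: (rep_cls (env_equiv (nplus C A))). Qed.

Lemma Uenv_eval1 : Uenv_eval 1 = 1%:M. Proof. exact: Uenv_eval_cls. Qed.

Lemma Uenv_evalD x y : Uenv_eval (x + y) = Uenv_eval x + Uenv_eval y.
Proof.
elim/quotW: x => x; elim/quotW: y => y.
by rewrite {1}/GRing.add /= -cls_EAdd !Uenv_eval_cls.
Qed.

Lemma Uenv_evalZ a x : Uenv_eval (a *: x) = a *: Uenv_eval x.
Proof.
elim/quotW: x => x.
by rewrite {1}/GRing.scale /= -cls_EScale !Uenv_eval_cls.
Qed.

Lemma Uenv_evalM x y : Uenv_eval (x * y) = Uenv_eval x *m Uenv_eval y.
Proof.
elim/quotW: x => x; elim/quotW: y => y.
by rewrite {1}/GRing.mul /= -cls_EMul !Uenv_eval_cls.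
Qed.

Lemma Uenv_evalB x y : Uenv_eval (x - y) = Uenv_eval x - Uenv_eval y.
Proof. by rewrite -scaleN1r Uenv_evalD Uenv_evalZ scaleN1r. Qed.

Lemma Uenv_eval_egen i : Uenv_eval (egen C A i) = toC (N i).
Proof. by rewrite Uenv_eval_cls /= nplus_eval_cls. Qed.

Definition divpow_mx (i : 'I_n) (s : nat) : 'M[int]_m :=
  match s with 0 => 1%:M | 1 => N i | _ => 0 end.

Lemma Uenv_eval_divpow i s : Uenv_eval (divpow C A i s) = toC (divpow_mx i s).
Proof.
rewrite /divpow Uenv_evalZ; case: s => [|[|s]].
- by rewrite expr0 Uenv_eval1 fact0 invr1 scale1r map_mx1.
- by rewrite expr1 Uenv_eval_egen invr1 scale1r.
- rewrite !exprS mulrA 2!Uenv_evalM !Uenv_eval_egen -[toC _ *m toC _]map_mxM.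
  by rewrite N_sq0 !map_mx0 mul0mx scaler0.
Qed.

Lemma UZ_integral (u : UZ C A) :
  {P : 'M[int]_m | Uenv_eval (val u) = toC P}.
Proof.
apply: cid; case: u => u /= /asboolP; elim=> {u}.
- by move=> i s; exists (divpow_mx i s); rewrite Uenv_eval_divpow.
- by exists 1%:M; rewrite Uenv_eval1 map_mx1.
- move=> x y _ [P EP] _ [Q EQ]; exists (P - Q).
  by rewrite Uenv_evalB EP EQ map_mxB.
- move=> x y _ [P EP] _ [Q EQ]; exists (P *m Q).
  by rewrite Uenv_evalM EP EQ map_mxM.
Qed.

Definition UZ_eval (u : UZ C A) : 'M[int]_m := sval (UZ_integral u).

Lemma UZ_evalP u P : Uenv_eval (val u) = toC P -> UZ_eval u = P.
Proof.
rewrite (svalP (UZ_integral u)) => /matrixP E.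
by apply/matrixP => i j; have := E i j; rewrite !mxE => /intr_inj.
Qed.

Lemma UZ_evalE u : Uenv_eval (val u) = toC (UZ_eval u).
Proof. exact: svalP (UZ_integral u). Qed.

Lemma UZ_evalD u v : UZ_eval (u + v) = UZ_eval u + UZ_eval v.
Proof. by apply: UZ_evalP; rewrite map_mxD -!UZ_evalE Uenv_evalD. Qed.

Lemma UZ_evalM u v : UZ_eval (u * v) = UZ_eval u *m UZ_eval v.
Proof. by apply: UZ_evalP; rewrite map_mxM -!UZ_evalE Uenv_evalM. Qed.

Lemma UZ_eval1 : UZ_eval 1 = 1%:M.
Proof. by apply: UZ_evalP; rewrite map_mx1 Uenv_eval1. Qed.

Lemma UZ_eval_divp i s : UZ_eval (UZ_divp C A i s) = divpow_mx i s.
Proof. by apply: UZ_evalP; rewrite Uenv_eval_divpow. Qed.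

Variable K : fieldType.
Local Notation toK := (map_mx (intr : int -> K)).

Definition UK_eval : UK C A K -> 'M[K]_m :=
  tens_lift (fun u a => a *: toK (UZ_eval u)).

Let fDl (u u' : UZ C A) (a : K) :
  a *: toK (UZ_eval (u + u')) = a *: toK (UZ_eval u) + a *: toK (UZ_eval u').
Proof. by rewrite UZ_evalD map_mxD scalerDr. Qed.
Let fDr (u : UZ C A) (a a' : K) :
  (a + a') *: toK (UZ_eval u) = a *: toK (UZ_eval u) + a' *: toK (UZ_eval u).
Proof. by rewrite scalerDl. Qed.

Lemma UK_eval_pure u a : UK_eval (tpure u a) = a *: toK (UZ_eval u).
Proof. exact: tens_lift_pure. Qed.
Lemma UK_eval0 : UK_eval 0 = 0. Proof. exact: tens_lift0. Qed.
Lemma UK_evalD x y : UK_eval (x + y) = UK_eval x + UK_eval y.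
Proof. exact: tens_liftD. Qed.
Lemma UK_evalN x : UK_eval (- x) = - UK_eval x.
Proof. exact: tens_liftN. Qed.

Lemma UK_eval1 : UK_eval 1 = 1%:M.
Proof. by rewrite -tpure1 UK_eval_pure UZ_eval1 map_mx1 scale1r. Qed.

Lemma UK_evalM x y : UK_eval (x * y) = UK_eval x *m UK_eval y.
Proof.
elim/tensor_ind: x => [u a||x x' IHx IHx'|x IHx].
- elim/tensor_ind: y => [v b||y y' IHy IHy'|y IHy].
  + rewrite tpureM !UK_eval_pure UZ_evalM map_mxM.
    by rewrite -scalemxAl -scalemxAr scalerA.
  + by rewrite mulr0 UK_eval0 mulmx0.
  + by rewrite mulrDr !UK_evalD IHy IHy' mulmxDr.
  + by rewrite mulrN !UK_evalN IHy mulmxN.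
- by rewrite mul0r UK_eval0 mul0mx.
- by rewrite mulrDl !UK_evalD IHx IHx' mulmxDl.
- by rewrite mulNr !UK_evalN IHx mulNmx.
Qed.

(** P is the image of u = (u_d) under e_i |-> t N_i, that is, the sum of the t^d
    u_d, required to be a polynomial in t.  The N_i need not generate a
    nilpotent algebra, so for a general u the sum is only a power series and
    cannot be evaluated at t = 1. *)
Definition Uhat_poly (u : Uhat C A K) (P : 'M[{poly K}]_m) : Prop :=
  forall d i j, (P i j)`_d = UK_eval (u d) i j.

Lemma Uhat_poly_inj u P Q : Uhat_poly u P -> Uhat_poly u Q -> P = Q.
Proof.
by move=> uP uQ; apply/matrixP => i j; apply/polyP => d; rewrite uP uQ.
Qed.

Lemma Uhat_poly1 : Uhat_poly 1 1%:M.
Proof.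
move=> d i j; rewrite mxE coefMn coef1 /=; case: d => [|d] /=.
  by rewrite UK_eval1 mxE.
by rewrite UK_eval0 mxE mul0rn.
Qed.

Lemma Uhat_polyM u v P Q :
  Uhat_poly u P -> Uhat_poly v Q -> Uhat_poly (u * v) (P *m Q).
Proof.
move=> uP vQ d i j; rewrite mxE coef_sum.
have -> : UK_eval ((u * v) d)
  = \sum_(e < d.+1) UK_eval (u e) *m UK_eval (v (d - e)%N).
  rewrite (big_morph _ UK_evalD UK_eval0).
  by apply: eq_bigr => e _; rewrite UK_evalM.
rewrite summxE; under [RHS]eq_bigr do rewrite mxE.
rewrite exchange_big /=; apply: eq_bigr => l _.
by rewrite coefM; apply: eq_bigr => e _; rewrite uP vQ.
Qed.

Lemma Uhat_poly_xexp i l :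
  Uhat_poly (xexp C A i l)
            (1%:M + (l *: 'X) *: map_mx (intr : int -> {poly K}) (N i)).
Proof.
move=> d j j'; rewrite /= UK_eval_pure UZ_eval_divp !mxE coefD coefMn coef1.
rewrite -[(N i j j')%:~R](rmorph_int (@polyC K)) -scalerAl coefZ coefMC coefX.
case: d => [|[|d]] /=; rewrite ?mxE.
- by rewrite mul0r mulr0 addr0 expr0 mul1r; case: eqP.
- by rewrite mul0rn add0r mul1r expr1.
- by rewrite mul0rn add0r mul0r !mulr0.
Qed.

End Representation.

Section Homomorphism.
Variables (R : realType) (n : nat) (A : 'M[int]_n) (K : fieldType).

(** The inverse of x_i(l) is x_i(- l), so that the generators of the group also
    generate it as a monoid. *)
Lemma Uplus_ind (P : Uplus R A K -> Prop) :
    P 1%g -> (forall x y, P x -> P y -> P (x * y)%g) ->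
    (forall i l, P (xroot R A i l)) ->
  forall u, P u.
Proof.
move=> P1 PM Px u.
pose Q g := exists2 v : Uplus R A K, val v = g & P v.
suff QQ g : in_gen (fun u : units (Uhat _ A K) => exists i l, u
  = xunit R A i l) g ->
    Q g /\ Q g^-1%g.
  have [[v uv Pv] _] := QQ _ (asboolP _ (valP u)).
  by rewrite -(val_inj uv).
elim=> {g} [_ [i [l ->]]||x y _ [[v vx Pv] [v' vx' Pv']] _ [[w wy Pw] [w' wy'
  Pw']]].
- split; first by exists (xroot R A i l).
  exists (xroot R A i (- l)) => //; apply: units_inj; exact.
- by rewrite invg1; split; exists 1%g => //; rewrite gmulf1.
- split; first by exists (v * w')%g; [rewrite -vx -wy' | apply: PM].
  by exists (w * v')%g; [rewrite invgF -vx' -wy | apply: PM].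
Qed.

Variables (m : nat) (N : 'I_n -> 'M[int]_m).
Hypothesis N_sq0 : forall i, N i *m N i = 0.
Hypothesis N_serre : forall i j, i != j ->
  iter `|1 - A i j|%N (mx_br (N i)) (N j) = 0.

(** Generators are represented by the polynomial matrices 1 + l t N_i; hence so
    is every element, and evaluation at t = 1 makes sense on the group. *)
Lemma Uplus_hom : exists f : Uplus R A K -> 'M[K]_m,
  [/\ f 1%g = 1%:M, {morph f : x y / (x * y)%g >-> x *m y} &
      forall i l, f (xroot R A i l) = 1%:M + l *: map_mx intr (N i)].
Proof.
pose rep (u : Uplus R A K) P := Uhat_poly N_sq0 N_serre (uval (val u)) P.
have rep1 : rep 1%g 1%:M by apply: Uhat_poly1.
have repM x y P Q : rep x P -> rep y Q -> rep (x * y)%g (P *m Q).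
  exact: Uhat_polyM.
have repx i l : rep (xroot R A i l) _ :=
    Uhat_poly_xexp _ N_sq0 N_serre i l.
have repE u : {P | rep u P}.
  apply: cid; elim/Uplus_ind: u => [|x y [P xP] [Q yQ]|i l].
  - by exists 1%:M.
  - by exists (P *m Q); apply: repM.
  - by eexists; apply: repx.
pose f u := map_mx (horner_eval 1) (sval (repE u)).
have fE u P : rep u P -> f u = map_mx (horner_eval 1) P.
  by move=> uP; rewrite /f (Uhat_poly_inj (svalP (repE u)) uP).
exists f; split=> [|x y|i l].
- by rewrite (fE _ _ rep1) map_mx1.
- by rewrite (fE _ _ (repM _ _ _ _ (svalP (repE x)) (svalP (repE y)))) map_mxM.
- rewrite (fE _ _ (repx i l)); apply/matrixP => j j'.
  rewrite !mxE /horner_eval -[(N i j j')%:~R](rmorph_int (@polyC K)).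
  by rewrite !hornerE hornerMn hornerC.
Qed.

End Homomorphism.

(** * One-parameter unipotent subgroups and their commutators *)

Section RootSubgroups.
Variables (K : fieldType) (n : nat) (P : 'M[K]_n -> Prop).
Hypothesis PM : forall X Y, P X -> P Y -> P (X *m Y).

(** For N of square zero this says that P contains the one-parameter group of N.
    Quantifying over all t makes the set of such N stable under scaling, so that
    questions about root subgroups become linear algebra. *)
Definition root_in (N : 'M[K]_n) := forall t, P (1%:M + t *: N).

Lemma root_inZ a N : root_in N -> root_in (a *: N).
Proof. by move=> PN t; rewrite scalerA; apply: PN. Qed.

Lemma root_inN N : root_in N -> root_in (- N).
Proof. by rewrite -scaleN1r; apply: root_inZ. Qed.

(** The vanishing of one of the two products suffices, as the factors are
    multiplied in that order. *)
Lemma root_inD N M : N *m M = 0 -> root_in N -> root_in M -> root_in (N + M).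
Proof.
move=> NM0 PN PM' t; have := PM (PN t) (PM' t).
rewrite mulmxDl mul1mx mulmxDr mulmx1 -scalemxAr -scalemxAl NM0 !scaler0 addr0.
by rewrite scalerDr addrAC addrA.
Qed.

Lemma commutator_unipotent (N M : 'M[K]_n) :
    N *m N = 0 -> M *m M = 0 -> M *m N *m M = 0 ->
  (1%:M + N) *m (1%:M + M) *m (1%:M - N) *m (1%:M - M) =
  1%:M + (N *m M - M *m N) - N *m M *m N.
Proof.
move=> NN MM MNM.
rewrite !(mulmxDl, mulmxDr, mulmxN, mulNmx, mulmx1, mul1mx, mulmxA) NN MM MNM.
rewrite -(mulmxA N M M) MM mulmx0 !mul0mx -!mulmxA (mulmxA M N M) MNM mulmx0.
by apply/matrixP => i j; rewrite !mxE; ring.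
Qed.

(** Commutators (1 + aN, 1 + tM) have the form 1 + at D - a^2 t Q with D = NM -
    MN and Q = NMN.  Replacing a by - a changes the sign of the first term only,
    and D, Q generate an algebra with zero product; hence the product of the two
    commutators isolates Q, and then D.  Halving is where odd characteristic
    enters. *)
Lemma root_in_commutator N M :
    2%:R != 0 :> K -> N *m N = 0 -> M *m M = 0 -> M *m N *m M = 0 ->
    root_in N -> root_in M ->
  root_in (N *m M - M *m N) /\ root_in (N *m M *m N).
Proof.
move=> nz2 NN MM MNM PN PM'.
set D := N *m M - M *m N; set Q := N *m M *m N.
have Pg a t : P (1%:M + (a * t) *: D - (a * a * t) *: Q).
  have -> : 1%:M + (a * t) *: D - (a * a * t) *: Q =
      (1%:M + a *: N) *m (1%:M + t *: M) *m (1%:M + (- a) *: N)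
        *m (1%:M + (- t) *: M).
    rewrite !scaleNr commutator_unipotent.
    - congr (_ + _ - _); rewrite /D /Q -!scalemxAl -!scalemxAr !scalerA ?mulrA.
        by rewrite scalerBr (mulrC t).
      by rewrite -scalemxAl scalerA.
    - by rewrite -scalemxAl -scalemxAr NN !scaler0.
    - by rewrite -scalemxAl -scalemxAr MM !scaler0.
    - by rewrite -!scalemxAl -!scalemxAr -scalemxAl MNM !scaler0.
  by do 3![apply: PM => //].
have NMNM : N *m M *m N *m M = 0 by rewrite -!mulmxA (mulmxA M) MNM mulmx0.
have NMM : N *m M *m M = 0 by rewrite -mulmxA MM mulmx0.
have MNN : M *m N *m N = 0 by rewrite -mulmxA NN mulmx0.
have NQ : Q *m N = 0 by rewrite /Q -mulmxA NN mulmx0.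
have QQ : Q *m Q = 0 by rewrite {2}/Q !mulmxA NQ !mul0mx.
have QD : Q *m D = 0 by rewrite mulmxBr !mulmxA NQ NMNM !mul0mx subr0.
have DQ : D *m Q = 0.
  by rewrite /Q mulmxBl !mulmxA NMNM MNN !mul0mx subr0.
have DD : D *m D = 0.
  rewrite {2}/D mulmxBr !mulmxBl !mulmxA NMNM NMM MNN MNM.
  by rewrite !mul0mx !subr0.
have PQ : root_in Q.
  move=> t; have := PM (Pg 1 (- t / 2%:R)) (Pg (- 1) (- t / 2%:R)).
  congr P; rewrite !mul1r !mulN1r opprK mul1r.
  rewrite !(mulmxDl, mulmxDr, mulmxN, mulNmx, mulmx1, mul1mx).
  rewrite -!scalemxAl -!scalemxAr QQ QD DQ DD.
  apply/matrixP => i j; rewrite !mxE; field.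
  exact: nz2.
split=> // t; have := PM (Pg 1 t) (PQ t).
congr P; rewrite !mul1r.
rewrite !(mulmxDl, mulmxDr, mulmxN, mulNmx, mulmx1, mul1mx).
rewrite -!scalemxAl -!scalemxAr QQ DQ.
by apply/matrixP => i j; rewrite !mxE; ring.
Qed.

Lemma root_in_mul N M :
    N *m N = 0 -> M *m M = 0 -> M *m N = 0 ->
  root_in N -> root_in M -> root_in (N *m M).
Proof.
move=> NN MM MN PN PM' t.
have -> : 1%:M + t *: (N *m M) = (1%:M + t *: N) *m (1%:M + 1 *: M)
    *m (1%:M + (- t) *: N) *m (1%:M + (- 1) *: M).
  rewrite !scaleNr !scale1r commutator_unipotent //.
  - by rewrite -scalemxAl -!scalemxAr -scalemxAl -mulmxA MN mulmx0 !scaler0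
    !subr0.
  - by rewrite -scalemxAl -scalemxAr NN !scaler0.
  - by rewrite -scalemxAr MN scaler0 mul0mx.
by do 3![apply: PM => //].
Qed.

Lemma root_in_morph p q (h : 'M[K]_(p, q) -> 'M[K]_n) :
    P 1%:M -> {morph h : X Y / X + Y} ->
    (forall a X, h (a *: X) = a *: h X) ->
    (forall X Y, h X *m h Y = 0) ->
    (forall i j, root_in (h (delta_mx i j))) ->
  forall B, root_in (h B).
Proof.
move=> P1 hD hZ hM Pd B; rewrite [B]matrix_sum_delta.
have P0 : root_in (h 0).
  by move=> t; rewrite -(scale0r (0 : 'M_(p, q))) hZ scale0r scaler0 addr0.
have PD X Y : root_in (h X) -> root_in (h Y) -> root_in (h (X + Y)).
  by move=> PX PY; rewrite hD; apply: root_inD.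
elim/big_ind: _ => // i _; elim/big_ind: _ => // j _.
by rewrite hZ; apply: root_inZ.
Qed.

End RootSubgroups.

(** * Generation of SL and Sp by unipotent blocks *)

Lemma mul_block_mx_diag (K : fieldType) m n (A A' : 'M[K]_m) (D D' : 'M[K]_n) :
  block_mx A 0 0 D *m block_mx A' 0 0 D' = block_mx (A *m A') 0 0 (D *m D').
Proof. by rewrite mulmx_block !(mul0mx, mulmx0, addr0, add0r). Qed.

Lemma det_elementary (K : fieldType) n (i j : 'I_n) (t : K) :
  i != j -> \det (1%:M + t *: delta_mx i j) = 1.
Proof.
wlog ij : i j / (j < i)%N => [det_lt|] neq_ij.
  have := neq_ij; rewrite neq_ltn => /orP[lt_ij|lt_ji]; last exact: det_lt.
  rewrite -det_tr linearD /= trmx1 linearZ /= trmx_delta.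
  by apply: det_lt; rewrite // eq_sym.
have trig : is_trig_mx (1%:M + t *: delta_mx i j : 'M[K]_n).
  apply/is_trig_mxP => u v uv; rewrite !mxE.
  have -> : (u == v) = false by apply/negbTE; rewrite neq_ltn uv.
  case: eqP => [ui|_]; case: eqP => [vj|_]; rewrite ?mulr0 ?addr0 //.
  by move: uv; rewrite ui vj ltnNge ltnW.
rewrite (det_trig trig) big1 // => u _; rewrite !mxE eqxx.
case: eqP => [->|_]; last by rewrite mulr0 addr0.
by rewrite (negPf neq_ij) mulr0 addr0.
Qed.

Lemma delta_mx_lr (K : fieldType) m n (i : 'I_m) (j : 'I_n) :
  delta_mx (lshift n i) (rshift m j)
    = block_mx 0 (delta_mx i j) 0 0 :> 'M[K]_(m + n).
Proof. by rewrite delta_mx_ushift delta_mx_rshift /block_mx row_mx0. Qed.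

Lemma delta_mx_rl (K : fieldType) m n (i : 'I_n) (j : 'I_m) :
  delta_mx (rshift m i) (lshift n j)
    = block_mx 0 0 (delta_mx i j) 0 :> 'M[K]_(m + n).
Proof. by rewrite delta_mx_dshift delta_mx_lshift /block_mx row_mx0. Qed.

Section BlockRoots.
Variables (K : fieldType) (m n : nat) (P : 'M[K]_(m + n) -> Prop).
Hypothesis P1 : P 1%:M.
Hypothesis PM : forall X Y, P X -> P Y -> P (X *m Y).

Lemma root_in_ur (B : 'M[K]_(m, n)) :
  (forall i j, root_in P (delta_mx (lshift n i) (rshift m j))) ->
  root_in P (block_mx 0 B 0 0).
Proof.
move=> Pd.
apply: (root_in_morph PM (h := fun B => block_mx 0 B 0 0)) => //.
- by move=> X Y; rewrite add_block_mx !addr0.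
- by move=> a X; rewrite scale_block_mx !scaler0.
- by move=> X Y; rewrite mulmx_block !(mul0mx, mulmx0, addr0) block_mx0.
- by move=> i j; rewrite -delta_mx_lr.
Qed.

Lemma root_in_dl (B : 'M[K]_(n, m)) :
  (forall i j, root_in P (delta_mx (rshift m i) (lshift n j))) ->
  root_in P (block_mx 0 0 B 0).
Proof.
move=> Pd.
apply: (root_in_morph PM (h := fun B => block_mx 0 0 B 0)) => //.
- by move=> X Y; rewrite add_block_mx !addr0.
- by move=> a X; rewrite scale_block_mx !scaler0.
- by move=> X Y; rewrite mulmx_block !(mul0mx, mulmx0, addr0) block_mx0.
- by move=> i j; rewrite -delta_mx_rl.
Qed.

Lemma root_in1 (N : 'M[K]_(m + n)) : root_in P N -> P (1%:M + N).
Proof. by move=> /(_ 1); rewrite scale1r. Qed.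

End BlockRoots.

Lemma block_mx_ur1 (K : fieldType) m n (B : 'M[K]_(m, n)) :
  1%:M + block_mx 0 B 0 0 = block_mx 1%:M B 0 1%:M.
Proof. by rewrite scalar_mx_block add_block_mx !addr0 add0r. Qed.

Lemma block_mx_dl1 (K : fieldType) m n (B : 'M[K]_(n, m)) :
  1%:M + block_mx 0 0 B 0 = block_mx 1%:M 0 B 1%:M.
Proof. by rewrite scalar_mx_block add_block_mx !addr0 add0r. Qed.

(** Gaussian elimination: a column operation makes the corner entry 1 (when the
    corner is the only nonzero entry of the first row, it is first copied to the
    next column), after which the matrix is the product of a lower unipotent
    matrix, of diag(1, Z) with det Z = 1, and of an upper one.  The induction
    hypothesis is used for the predicate Z |-> P (diag (1, Z)). *)
Lemma SL_elementary (K : fieldType) n (P : 'M[K]_n -> Prop) :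
    P 1%:M -> (forall X Y, P X -> P Y -> P (X *m Y)) ->
    (forall i j, i != j -> root_in P (delta_mx i j)) ->
  forall X, \det X = 1 -> P X.
Proof.
elim: n P => [|n IHn] P P1 PM Pe X dX.
  by rewrite [X](_ : _ = 1%:M) //; apply/matrixP => -[].
have dE := @det_elementary K n.+1.
have EK i j t : i != j ->
    (1%:M + t *: delta_mx i j) *m (1%:M + (- t) *: delta_mx i j) = 1%:M
      :> 'M[K]_n.+1.
  move=> ij; rewrite mulmxDl mul1mx mulmxDr mulmx1 -scalemxAl -scalemxAr.
  rewrite mul_delta_mx_0 1?eq_sym // !scaler0 addr0 -addrA -scalerDl.
  by rewrite addNr scale0r addr0.
have col_op (Y : 'M[K]_n.+1) i j t r :
    (Y *m (1%:M + t *: delta_mx i j)) r j = Y r j + t * Y r i.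
  rewrite mulmxDr mulmx1 -scalemxAr !mxE (bigD1 i) //= !mxE !eqxx mulr1.
  by rewrite big1 ?addr0 // => l /negPf il; rewrite !mxE il mulr0.
have Pback i j t Y : i != j -> P (Y *m (1%:M + t *: delta_mx i j)) -> P Y.
  move=> ij PY; rewrite -[Y]mulmx1 -(EK i j t ij) mulmxA.
  by apply: PM => //; apply: Pe.
have P_corner1 (Y : 'M[K]_(1 + n)) : \det Y = 1 -> Y 0 0 = 1 -> P Y.
  move=> dY Y00; rewrite -[Y]submxK.
  have U00 : ulsubmx Y = 1%:M.
    by apply/matrixP => i j; rewrite !ord1 !mxE !lshift0 Y00.
  rewrite U00; set r := ursubmx Y; set c := dlsubmx Y; set D := drsubmx Y.
  have E : block_mx 1%:M r c D = block_mx 1%:M 0 c 1%:M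
      *m block_mx 1%:M 0 0 (D - c *m r) *m block_mx 1%:M r 0 1%:M.
    rewrite !mulmx_block !(mul0mx, mulmx0, mul1mx, mulmx1, addr0, add0r).
    by rewrite addrC subrK.
  rewrite E.
  have {E dY} dD : \det (D - c *m r) = 1.
    move: dY; rewrite -{1}[Y]submxK U00 -/r -/c -/D E !det_mulmx det_lblock
      det_ublock.
    by rewrite det_ublock !det1 !mul1r mulr1.
  have P_ur : P (block_mx 1%:M r 0 1%:M).
    rewrite -block_mx_ur1; apply: (@root_in1 K 1 n).
    apply: (@root_in_ur K 1 n) => // i j.
    by apply: (Pe); rewrite -val_eqE /= ord1.
  have P_dl : P (block_mx 1%:M 0 c 1%:M).
    rewrite -block_mx_dl1; apply: (@root_in1 K 1 n).
    apply: (@root_in_dl K 1 n) => // i j.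
    by apply: (Pe); rewrite -val_eqE /= ord1.
  apply: (PM) => //; apply: (PM) => //.
  pose P' Z := P (block_mx (1%:M : 'M_1) 0 0 Z).
  apply: (IHn P') => [|Z Z' PZ PZ'|i j ij t|].
  - by rewrite /P' -scalar_mx_block.
  - have PM1 : forall X1 X2 : 'M[K]_(1 + n), P X1 -> P X2 -> P (X1 *m X2) by [].
    by have := PM1 _ _ PZ PZ'; rewrite mul_block_mx_diag mulmx1.
  - rewrite /P'.
    have -> : block_mx 1%:M 0 0 (1%:M + t *: delta_mx i j) =
        1%:M + t *: delta_mx (rshift 1 i) (rshift 1 j) :> 'M[K]_(1 + n).
      rewrite delta_mx_dshift delta_mx_rshift -[0 in RHS](row_mx0 K 1 1 n).
      by rewrite scalar_mx_block scale_block_mx add_block_mx !scaler0 !addr0.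
    by apply: (Pe); rewrite -val_eqE /= eqSS.
  - exact: dD.
have P_row (Y : 'M[K]_n.+1) j : \det Y = 1 -> j != 0 -> Y 0 j != 0 -> P Y.
  move=> dY j0 Yj; apply: (Pback j 0 ((1 - Y 0 0) / Y 0 j)) => //.
  apply: P_corner1; first by rewrite det_mulmx dY dE // mulr1.
  by rewrite col_op divfK // addrC subrK.
have [j /andP[j0 Yj]|Y0] := pickP (fun j => (j != 0) && (X 0 j != 0)).
  exact: P_row Yj.
have X00 : X 0 0 != 0.
  apply/eqP => X00; have /eqP := dX; rewrite (expand_det_row _ 0) big1.
    by rewrite eq_sym oner_eq0.
  move=> j _; have [->|j0] := eqVneq j 0; first by rewrite X00 mul0r.
  by have /negbT := Y0 j; rewrite j0 negbK => /eqP->; rewrite mul0r.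
case: n => [|n] in P P1 PM Pe X dX dE EK col_op Pback P_corner1 P_row Y0 X00
  IHn *.
  by apply: P_corner1 => //; rewrite -dX det_mx11.
apply: (Pback 0 1 1) => //; apply: (P_row _ 1) => //.
  by rewrite det_mulmx dX dE // mulr1.
rewrite col_op mul1r; have /negbT := Y0 1; rewrite /= negbK => /eqP->.
by rewrite add0r.
Qed.

Section Symplectic.
Variables (K : fieldType) (m : nat).

Definition symplectic (X : 'M[K]_(m + m)) := X^T *m Omega K m *m X = Omega K m.

Lemma symplecticM X Y : symplectic X -> symplectic Y -> symplectic (X *m Y).
Proof.
rewrite /symplectic => HX HY.
by rewrite trmx_mul -!mulmxA (mulmxA (Omega _ _)) (mulmxA X^T) mulmxA (mulmxA
  X^T) HX.
Qed.

Lemma symplectic_ur (B : 'M[K]_m) : B^T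
  = B -> symplectic (block_mx 1%:M B 0 1%:M).
Proof.
move=> BT; rewrite /symplectic /Omega tr_block_mx !mulmx_block !trmx1 !trmx0 BT.
by rewrite !(mul0mx, mulmx0, mul1mx, mulmx1, addr0, add0r, mulmxN, mulNmx)
  subrr.
Qed.

Lemma symplectic_dl (B : 'M[K]_m) : B^T
  = B -> symplectic (block_mx 1%:M 0 B 1%:M).
Proof.
move=> BT; rewrite /symplectic /Omega tr_block_mx !mulmx_block !trmx1 !trmx0 BT.
by rewrite !(mul0mx, mulmx0, mul1mx, mulmx1, addr0, add0r, mulmxN, mulNmx)
  subrr.
Qed.

Lemma symplectic_diag (g : 'M[K]_m) :
  g \in unitmx -> symplectic (block_mx g 0 0 (invmx g^T)).
Proof.
move=> gU; rewrite /symplectic /Omega tr_block_mx !mulmx_block !trmx0 trmx_inv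
  trmxK.
rewrite !(mul0mx, mulmx0, mulmx1, addr0, add0r, mulmxN, mulNmx).
by rewrite mulVmx // mulmxV ?unitmx_tr.
Qed.

Lemma Omega_sq : Omega K m *m Omega K m = - 1%:M.
Proof.
rewrite /Omega mulmx_block scalar_mx_block opp_block_mx.
by rewrite !(mul0mx, mulmx0, mul1mx, mulmx1, addr0, add0r, mulmxN, mulNmx)
  oppr0.
Qed.

Lemma symplectic_rows X : symplectic X -> X *m Omega K m *m X^T = Omega K m.
Proof.
move=> HX; pose Y := - (Omega K m *m X^T *m Omega K m).
have YX : Y *m X = 1%:M.
  by rewrite mulNmx -!mulmxA (mulmxA X^T) HX Omega_sq opprK.
have XY : X *m Y = 1%:M by apply: mulmx1C.
have := congr1 (mulmx^~ (Omega K m)) XY.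
rewrite /Y mulmxN mulNmx !mulmxA -(mulmxA _ (Omega K m) (Omega K m)) Omega_sq.
by rewrite mulmxN opprK mulmx1 mul1mx.
Qed.

Lemma symplectic_blocks A B C D : symplectic (block_mx A B C D) ->
  [/\ B *m A^T = A *m B^T, C^T *m A = A^T *m C & D *m A^T - C *m B^T = 1%:M].
Proof.
move=> HX; have := symplectic_rows HX; have := HX.
rewrite /symplectic /Omega tr_block_mx !mulmx_block.
rewrite !(mul0mx, mulmx0, mul1mx, mulmx1, addr0, add0r, mulmxN, mulNmx).
move=> /eq_block_mx[E1 _ _ _] /eq_block_mx[E2 _ E3 _]; split.
- by apply/eqP; rewrite -subr_eq0 E2.
- by apply/eqP; rewrite -subr_eq0 E1.
- exact: E3.
Qed.

End Symplectic.

Section BlockGeneration.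
Variables (K : fieldType) (m : nat) (P : 'M[K]_(m + m) -> Prop).
Hypothesis PM : forall X Y, P X -> P Y -> P (X *m Y).

(** An elementary matrix inside a diagonal block is a commutator of two
    elementary matrices that pass through the other half of the indices. *)
Lemma SL_block_generated :
    (forall B, P (block_mx 1%:M B 0 1%:M)) ->
    (forall B, P (block_mx 1%:M 0 B 1%:M)) ->
  forall X, \det X = 1 -> P X.
Proof.
move=> PU PL.
have Plr i j : root_in P (delta_mx (lshift m i) (rshift m j)).
  move=> t; rewrite delta_mx_lr scale_block_mx !scaler0 block_mx_ur1.
  exact: PU.
have Prl i j : root_in P (delta_mx (rshift m i) (lshift m j)).
  move=> t; rewrite delta_mx_rl scale_block_mx !scaler0 block_mx_dl1.
  exact: PL.
have via i j l : i != l -> l != j -> i != j -> root_in P (delta_mx i l) ->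
    root_in P (delta_mx l j) -> root_in P (delta_mx i j).
  move=> il lj ij Pil Plj; rewrite -(mul_delta_mx l i j).
  by apply: root_in_mul => //; rewrite mul_delta_mx_0 // eq_sym.
apply: SL_elementary => // [|i j].
  by have := PU 0; rewrite -scalar_mx_block.
case: (split_ordP i) => i' ->; case: (split_ordP j) => j' -> // ij.
  by apply: (via _ _ (rshift m i')); rewrite ?eq_lrshift ?eq_rlshift.
by apply: (via _ _ (lshift m i')); rewrite ?eq_lrshift ?eq_rlshift.
Qed.

Hypothesis PU : forall B, B^T = B -> P (block_mx 1%:M B 0 1%:M).
Hypothesis PL : forall B, B^T = B -> P (block_mx 1%:M 0 B 1%:M).

(** With w(h) = U(h) L(- h^-1) U(h), where U and L are the upper and lower
    unipotent blocks, the matrix is w(g) w(- 1). *)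
Lemma block_diag_sym_inv (g : 'M[K]_m) : g \in unitmx -> g^T = g ->
  P (block_mx g 0 0 (invmx g^T)).
Proof.
move=> gU gT.
have Pw (h : 'M[K]_m) : h \in unitmx -> h^T
  = h -> P (block_mx 0 h (- invmx h) 0).
  move=> hU hT.
  have -> : block_mx 0 h (- invmx h) 0 = block_mx 1%:M h 0 1%:M
      *m block_mx 1%:M 0 (- invmx h) 1%:M *m block_mx 1%:M h 0 1%:M.
    rewrite !mulmx_block !(mul0mx, mulmx0, mul1mx, mulmx1, addr0, add0r).
    by rewrite mulmxN mulNmx mulmxV // mulVmx // subrr mul0mx add0r addNr.
  apply: PM; [apply: PM|]; [exact: PU| |exact: PU].
  by apply: PL; rewrite linearN /= trmx_inv hT.
have N1U : - (1%:M : 'M[K]_m) \in unitmx.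
  by rewrite unitmxE -scaleN1r detZ det1 mulr1 unitrX ?unitrN ?unitr1.
have N1V : invmx (- 1%:M) = - 1%:M :> 'M[K]_m.
  apply: (can_inj (mulKmx N1U)).
  by rewrite mulmxV // mulNmx mulmxN opprK mulmx1.
have -> : block_mx g 0 0 (invmx g^T) =
    block_mx 0 g (- invmx g) 0 *m block_mx 0 (- 1%:M) (- invmx (- 1%:M)) 0.
  rewrite mulmx_block !(mul0mx, mulmx0, addr0, add0r) gT N1V.
  by rewrite opprK mulmx1 mulmxN mulmx1 opprK.
apply: PM; apply: Pw => //.
by rewrite linearN /= trmx1.
Qed.

(** GL_m is generated by elementary and diagonal matrices, and each of these is
    a product of invertible symmetric ones: with T the permutation matrix of the
    transposition (i j), 1 + t e_ij = (T + t e_ii) T. *)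
Lemma block_diag_generated (g : 'M[K]_m) :
  g \in unitmx -> P (block_mx g 0 0 (invmx g^T)).
Proof.
pose P' g := P (block_mx g 0 0 (invmx g^T)).
have PM' (g1 g2 : 'M_m) : g1 \in unitmx -> g2 \in unitmx ->
    P' g1 -> P' g2 -> P' (g1 *m g2).
  move=> u1 u2 p1 p2; have := PM p1 p2; rewrite mul_block_mx_diag.
  congr (P (block_mx _ _ _ _)).
  apply: (can_inj (mulKmx (_ : (g1 *m g2)^T \in unitmx))).
    by rewrite unitmx_tr unitmx_mul u1.
  rewrite mulmxV ?unitmx_tr ?unitmx_mul ?u1 // trmx_mul mulmxA.
  by rewrite -(mulmxA g2^T) mulmxV ?unitmx_tr // mulmx1 mulmxV ?unitmx_tr.
have Psym := block_diag_sym_inv.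
have P1 : P' 1%:M by apply: Psym; rewrite ?unitmx1 ?trmx1.
have Pe i j t : i != j -> P' (1%:M + t *: delta_mx i j).
  move=> ij; pose T : 'M[K]_m := tperm_mx i j.
  have TT : T *m T = 1%:M by rewrite -perm_mxM tperm2 perm_mx1.
  have TU : T \in unitmx by rewrite unitmx_perm.
  have TsymT : T^T = T by rewrite tr_perm_mx tpermV.
  have dT : delta_mx i i *m T = delta_mx i j.
    rewrite -[T]/(perm_mx _) -[tperm i j]invgK -col_permE tpermV.
    apply/matrixP => u v; rewrite !mxE; congr ((_ && _)%:R).
    by rewrite (canF_eq (tpermK i j)) tpermL.
  have dTj : delta_mx i j *m T = delta_mx i i by rewrite -dT -mulmxA TT mulmx1.
  have -> : 1%:M + t *: delta_mx i j = (T + t *: delta_mx i i) *m T.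
    by rewrite mulmxDl TT -scalemxAl dT.
  have SU : T + t *: delta_mx i i \in unitmx.
    have -> : T + t *: delta_mx i i = (1%:M + t *: delta_mx i j) *m T.
      by rewrite mulmxDl mul1mx -scalemxAl dTj.
    by rewrite unitmx_mul TU andbT unitmxE det_elementary ?unitr1.
  apply: PM' => //; apply: Psym => //.
  by rewrite linearD linearZ /= TsymT trmx_delta.
move=> gU; suff : P' g by [].
pose P'' X := X \in unitmx /\ P' X.
have PSL (X : 'M[K]_m) : \det X = 1 -> P'' X.
  apply: SL_elementary => [|X1 X2 [U1 p1] [U2 p2]|i j ij t].
  - by split; rewrite ?unitmx1.
  - by split; [rewrite unitmx_mul U1 | apply: PM'].
  - by split; [rewrite unitmxE det_elementary ?unitr1 | apply: Pe].
have [i0 _|m0] := pickP (@predT 'I_m); last first.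
  by rewrite [g](_ : _ = 1%:M) //; apply/matrixP => i; have := m0 i.
pose D (d : K) : 'M[K]_m := diag_mx (\row_j if j == i0 then d else 1).
have detD d : \det (D d) = d.
  rewrite det_diag (bigD1 i0) //= mxE eqxx big1 ?mulr1 // => j /negPf j0.
  by rewrite mxE j0.
have dnz : \det g != 0 by rewrite -unitfE -unitmxE.
have DU d : d != 0 -> D d \in unitmx by move=> d0; rewrite unitmxE detD unitfE.
have -> : g = g *m D (\det g)^-1 *m D (\det g).
  rewrite -mulmxA mulmx_diag (_ : diag_mx _ = 1%:M) ?mulmx1 //.
  rewrite -diag_const_mx; congr diag_mx; apply/rowP => j; rewrite !mxE.
  by case: ifP; rewrite ?mulVf ?mulr1.
have [gDU gDP] : P'' (g *m D (\det g)^-1).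
  by apply: PSL; rewrite det_mulmx detD divff.
apply: PM' => //; first exact: DU.
by apply: Psym; rewrite ?DU ?tr_diag_mx.
Qed.

Lemma Sp_block_generated_unit A B C D :
  A \in unitmx -> symplectic (block_mx A B C D) -> P (block_mx A B C D).
Proof.
move=> AU /symplectic_blocks[BA CA DA].
have ATU : A^T \in unitmx by rewrite unitmx_tr.
have symAB : (invmx A *m B)^T = invmx A *m B.
  rewrite trmx_mul trmx_inv; apply: (can_inj (mulKmx AU)).
  by rewrite mulmxA -BA mulKVmx // mulmxK.
have symCA : (C *m invmx A)^T = C *m invmx A.
  rewrite trmx_mul trmx_inv; apply: (can_inj (mulmxK AU)).
  by rewrite -[LHS]mulmxA CA mulKmx // mulmxKV.
have ED : D = C *m invmx A *m B + invmx A^T.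
  apply: (can_inj (mulmxK ATU));
    rewrite mulmxDl mulVmx // -(subrK (C *m B^T) (D *m _)) DA.
  rewrite addrC; congr (_ + _).
  by rewrite -(mulmxA C) -symAB trmx_mul trmx_inv -!mulmxA mulVmx ?mulmx1.
have -> : block_mx A B C D = block_mx 1%:M 0 (C *m invmx A) 1%:M
   *m block_mx A 0 0 (invmx A^T) *m block_mx 1%:M (invmx A *m B) 0 1%:M.
  rewrite !mulmx_block !(mul0mx, mulmx0, mul1mx, mulmx1, addr0, add0r) mulKVmx
    //.
  by rewrite mulmxKV // ED mulmxA.
apply: PM; [apply: PM|]; [exact: PL| |exact: PU].
exact: block_diag_generated.
Qed.

(** Let A = pid_mx r and S = copid_mx r, the complementary idempotent.  A row
    vector killed by A + B S is killed by A and by B S, then by B because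
    B A^T = A B^T, hence it is 0 because D A^T - C B^T = 1.  So multiplication
    by the lower unipotent matrix of S reduces to an invertible corner. *)
Lemma Sp_block_generated_pid r B C D : (r <= m)%N ->
  symplectic (block_mx (pid_mx r) B C D) -> P (block_mx (pid_mx r) B C D).
Proof.
move=> rm HX; have [BA _ DA] := symplectic_blocks HX.
pose S : 'M[K]_m := copid_mx r.
have ST : S^T = S by rewrite /S /copid_mx linearB /= trmx1 tr_pid_mx.
have AU : pid_mx r + B *m S \in unitmx.
  rewrite -row_free_unit; apply: inj_row_free => v v0.
  have vA : v *m (pid_mx r : 'M_m) = 0.
    have := congr1 (mulmx^~ (pid_mx r : 'M_m)) v0.
    rewrite mul0mx -mulmxA mulmxDl -(mulmxA B) mul_copid_mx_pid // mulmx0 addr0.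
    by rewrite pid_mx_id.
  have vB : v *m B = 0.
    move: v0; rewrite mulmxDr vA add0r /S /copid_mx mulmxA mulmxBr mulmx1.
    by rewrite -(tr_pid_mx K m m r) -(mulmxA v) BA mulmxA vA mul0mx subr0.
  have := congr1 (fun Z => v *m Z^T) DA; rewrite /= trmx1 mulmx1 => <-.
  by rewrite linearB /= !trmx_mul !trmxK mulmxBr !mulmxA vA vB !mul0mx subr0.
have EX : block_mx (pid_mx r) B C D *m block_mx 1%:M 0 S 1%:M =
    block_mx (pid_mx r + B *m S) B (C + D *m S) D.
  by rewrite mulmx_block !(mulmx0, mulmx1, add0r).
have PX : P (block_mx (pid_mx r) B C D *m block_mx 1%:M 0 S 1%:M).
  rewrite EX; apply: Sp_block_generated_unit => //.
  by rewrite -EX; apply: symplecticM => //; apply: symplectic_dl.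
have -> : block_mx (pid_mx r) B C D =
    block_mx (pid_mx r) B C D *m block_mx 1%:M 0 S 1%:M
      *m block_mx 1%:M 0 (- S) 1%:M.
  rewrite -mulmxA mulmx_block !(mul0mx, mulmx0, mul1mx, mulmx1, addr0, add0r)
    subrr.
  by rewrite -scalar_mx_block mulmx1.
by apply: PM => //; apply: PL; rewrite linearN /= ST.
Qed.

(** Left and right multiplication by matrices diag(g, g^-T) brings the upper
    left block to the normal form pid_mx r. *)
Lemma Sp_block_generated X : symplectic X -> P X.
Proof.
rewrite -[X]submxK; move: (ulsubmx X) (ursubmx X) (dlsubmx X) (drsubmx X).
move=> A B C D {X} HX.
pose g := col_ebase A; pose h := row_ebase A; pose r := \rank A.
have gU : g \in unitmx by exact: col_ebase_unit.
have hU : h \in unitmx by exact: row_ebase_unit.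
have gVU : invmx g \in unitmx by rewrite unitmx_inv.
have hVU : invmx h \in unitmx by rewrite unitmx_inv.
pose diag (u : 'M[K]_m) := block_mx u 0 0 (invmx u^T).
have diagV u : u \in unitmx -> diag u *m diag (invmx u) = 1%:M.
  move=> uU; rewrite mul_block_mx_diag mulmxV // trmx_inv invmxK mulVmx
    ?unitmx_tr //.
  by rewrite -scalar_mx_block.
pose Y := diag (invmx g) *m block_mx A B C D *m diag (invmx h).
have symY : symplectic Y by do 2?apply: symplecticM => //;
  exact: symplectic_diag.
have Yul : ulsubmx Y = pid_mx r.
  rewrite /Y /diag !mulmx_block !(mul0mx, mulmx0, addr0, add0r) block_mxKul.
  have EA : A = g *m pid_mx r *m h by rewrite mulmx_ebase.
  by rewrite [X in _ *m X *m _]EA !mulmxA mulVmx // mul1mx mulmxK.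
have EX : block_mx A B C D = diag g *m Y *m diag h.
  rewrite /Y !mulmxA diagV // mul1mx -mulmxA.
  by rewrite -{2}[h]invmxK diagV ?mulmx1.
suff PY : P Y.
  rewrite EX; apply: PM; [apply: PM|]; rewrite // /diag;
    exact: block_diag_generated.
rewrite -[Y]submxK Yul in symY *.
exact: Sp_block_generated_pid (rank_leq_row _) symY.
Qed.

End BlockGeneration.

(** * The algebra of pairs generated by shift matrices *)

(** The regular nilpotent matrix sending the row vector e_i to e_(i+1). *)
Definition shift_mx (K : pzRingType) n : 'M[K]_n :=
  \matrix_(i, j) (i.+1 == j :> nat)%:R.

Definition path_mx (K : pzRingType) n : 'M[K]_n :=
  shift_mx K n + (shift_mx K n)^T.

Section Shift.
Variables (K : comNzRingType) (n : nat).
Local Notation N := (shift_mx K n.+3).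

Lemma mul_delta_mxE m p q (i : 'I_m) (j : 'I_p) (X : 'M[K]_(p, q)) u v :
  (delta_mx i j *m X) u v = (u == i)%:R * X j v.
Proof.
rewrite mxE (bigD1 j) //= mxE eqxx andbT big1 ?addr0 // => l /negPf lj.
by rewrite mxE lj andbF mul0r.
Qed.

Lemma shift_delta : N *m delta_mx 2 0 = delta_mx 1 0 :> 'M_n.+3.
Proof.
apply/matrixP => u v; rewrite !mxE (bigD1 2) //= big1 ?addr0 => [|l /negPf l2].
  by rewrite !mxE eqxx -natrM mulnb; congr ((_ && _)%:R); rewrite -val_eqE /=;
    lia.
by rewrite !mxE l2 mulr0.
Qed.

Lemma delta_shift : delta_mx 2 0 *m N = delta_mx 2 1 :> 'M_n.+3.
Proof.
apply/matrixP => u v; rewrite mul_delta_mxE !mxE -natrM mulnb.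
by congr ((_ && _)%:R); rewrite -val_eqE eq_sym.
Qed.

Lemma mul_tr_shift : N^T *m N = 1%:M - delta_mx 0 0.
Proof.
apply/matrixP => u v; rewrite !mxE; case: u => -[|u] /= ltu.
  rewrite big1 => [|l _]; last by rewrite !mxE mul0r.
  rewrite -!val_eqE /=.
  by rewrite eq_sym subrr.
rewrite (bigD1 (Ordinal (ltnW ltu))) //= !mxE eqxx mul1r big1 ?addr0 => [|l].
  by rewrite -!val_eqE /= subr0.
by rewrite -val_eqE /= !mxE eqSS => /negPf->; rewrite mul0r.
Qed.

Lemma mul_shift_tr : N *m N^T = 1%:M - delta_mx ord_max ord_max.
Proof.
apply/matrixP => u v; rewrite !mxE; have [ltu|geu] := ltnP u.+1 n.+3.
  rewrite (bigD1 (Ordinal ltu)) //= !mxE eqxx mul1r big1 ?addr0 => [|l].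
    have -> : (u == ord_max) = false by apply/negbTE; rewrite -val_eqE /=; lia.
    by rewrite subr0 eqSS eq_sym.
  by rewrite -val_eqE /= !mxE eq_sym => /negPf->; rewrite mul0r.
have -> : u = ord_max by apply: val_inj => /=; have := ltn_ord u; lia.
rewrite big1 => [|l _]; last first.
  rewrite !mxE; case: eqP => [/= El|_]; last by rewrite mul0r.
  by have := ltn_ord l; rewrite -[X in (X < _)%N]El ltnn.
by rewrite eqxx eq_sym /= subrr.
Qed.

End Shift.

Section PathAlgebra.
Variables (K : fieldType) (n : nat) (S : 'M[K]_n.+1 -> Prop).
Hypothesis SD : forall X Y, S X -> S Y -> S (X + Y).
Hypothesis SZ : forall a X, S X -> S (a *: X).
Hypothesis S00 : S (delta_mx 0 0).

Lemma delta_path (i : nat) : (i < n)%N ->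
  delta_mx 0 (inord i) *m path_mx K n.+1 =
    delta_mx 0 (inord i.+1) + (0 < i)%:R *: delta_mx 0 (inord i.-1) :> 'M_n.+1.
Proof.
move=> lein; apply/matrixP => u v; rewrite mul_delta_mxE !mxE.
rewrite -!val_eqE /= !inordK ?ltnS //; try lia.
case: (u == 0 :> nat); rewrite ?mul0r ?mulr0 ?add0r ?mul1r //=.
rewrite eq_sym; congr (_ + _).
by case: i lein => [|i] lein; rewrite ?mul0r ?mul1r // eqSS.
Qed.

(** Right multiplication by the path matrix sends e_0j to e_0(j-1) + e_0(j+1),
    so it reaches all e_0j from e_00. *)
Lemma path_mx_row0 : (forall X, S X -> S (X *m path_mx K n.+1)) ->
  forall j, S (delta_mx 0 j).
Proof.
move=> SJ j; rewrite -[j]inord_val; have := leq_ord j.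
move: (val j) => i; elim/ltn_ind: i {j} => -[|i] IH lei.
  by rewrite (_ : inord 0 = 0) //; apply: val_inj; rewrite /= inordK.
have Si := IH i (ltnSn i) (ltnW lei).
have -> : delta_mx 0 (inord i.+1) = delta_mx 0 (inord i) *m path_mx K n.+1
    + (- (0 < i)%:R) *: delta_mx 0 (inord i.-1) :> 'M_n.+1.
  by rewrite delta_path // scaleNr addrK.
apply: SD; first exact: SJ.
by apply: SZ; apply: IH; lia.
Qed.

End PathAlgebra.

Lemma path_mx_generates (K : fieldType) n (S : 'M[K]_n.+1 -> Prop) :
    (forall X Y, S X -> S Y -> S (X + Y)) ->
    (forall a X, S X -> S (a *: X)) ->
    (forall X Y, S X -> S Y -> S (X *m Y)) ->
    S (delta_mx 0 0) -> S (path_mx K n.+1) ->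
  forall X, S X.
Proof.
move=> SD SZ SM S00 SJ X.
have S0 : S 0 by rewrite -(scale0r (delta_mx 0 0)); apply: SZ.
have Srow j : S (delta_mx 0 j).
  by apply: path_mx_row0 => // Y SY; apply: SM.
have Scol j : S (delta_mx j 0).
  rewrite -trmx_delta; apply: (path_mx_row0 (S :=
    fun Y => S Y^T)) => [Y Z|a Y||Y].
  - by rewrite linearD; apply: SD.
  - by rewrite linearZ; apply: SZ.
  - by rewrite trmx_delta.
  - by rewrite trmx_mul /path_mx linearD /= trmxK addrC; apply: SM.
rewrite [X]matrix_sum_delta; elim/big_ind: _ => // i _.
elim/big_ind: _ => // j _; apply: SZ.
by rewrite -(mul_delta_mx (0 : 'I_n.+1)); apply: SM.
Qed.

(** Pairs (X, X') are multiplied as in the ring of matrices times its opposite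
    ring.  In that ring exchanging the two entries is an involution, and the
    pairs (Y, Y) that it fixes are the symmetric elements.  When sym holds, the
    matrices W + W', W' W and W W' are symmetric, and they can only generate the
    pairs (X, X^T); without sym, W' is W^T with one further entry, which breaks
    this symmetry, and all pairs are generated. *)
Section PairAlgebra.
Variables (K : fieldType) (n : nat) (sym : bool).
Local Notation mx := 'M[K]_n.+3.
Variable Q : mx -> mx -> Prop.
Hypothesis QD : forall X X' Y Y', Q X X' -> Q Y Y' -> Q (X + Y) (X' + Y').
Hypothesis QZ : forall a X X', Q X X' -> Q (a *: X) (a *: X').
Hypothesis QM : forall X X' Y Y', Q X X' -> Q Y Y' -> Q (X *m Y) (Y' *m X').
Hypothesis Q1 : Q 1%:M 1%:M.

Local Notation eps := ((~~ sym)%:R : K).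
Let W : mx := 1%:M + shift_mx K n.+3.
Let W' : mx := 1%:M + ((shift_mx K n.+3)^T + eps *: delta_mx 2 0).

Hypothesis Qs : Q (W + W') (W + W').
Hypothesis Qt : Q (W' *m W) (W' *m W).
Hypothesis Qt' : Q (W *m W') (W *m W').

Let QN X X' : Q X X' -> Q (- X) (- X').
Proof. by rewrite -!scaleN1r; apply: QZ. Qed.
Let QB X X' Y Y' : Q X X' -> Q Y Y' -> Q (X - Y) (X' - Y').
Proof. by move=> QX QY; apply: QD => //; apply: QN. Qed.

(** As polynomials in the given elements one finds y1 = e_00 - eps e_21, y2 =
    e_mm - eps e_10 (m the last index) and y3 = path + eps e_20.  The squares
    of y1 and y2 are e_00 and e_mm, hence also eps e_10 and eps e_21.  Multiplying the last
    two in both orders separates the entries of the pair (e_20, e_20), and so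
    the pairs (e_00, e_00) and (path, path) are obtained, which generate all (X,
    X^T).  If eps = 1, then (e_10, e_10) (e_00, e_00) is the pair (e_10, 0),
    from which the first factor M_k x 0 is spanned. *)
Lemma pair_algebra X X' : (sym -> X' = X^T) -> Q X X'.
Proof.
pose y1 : mx := delta_mx 0 0 - eps *: delta_mx 2 1.
pose y2 : mx := delta_mx ord_max ord_max - eps *: delta_mx 1 0.
pose y3 : mx := path_mx K n.+3 + eps *: delta_mx 2 0.
have Qy1 : Q y1 y1.
  suff -> : y1 = (W + W') - W' *m W by apply: QB.
  rewrite /W /W' !(mulmxDl, mulmxDr, mulmx1, mul1mx) mul_tr_shift -scalemxAl.
  rewrite delta_shift /y1;
    move: (shift_mx _ _) (delta_mx 0 0) (delta_mx 2 1) (delta_mx 2 0).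
  by move=> A B C D; apply/matrixP => i j; rewrite !mxE; ring.
have Qy2 : Q y2 y2.
  suff -> : y2 = (W + W') - W *m W' by apply: QB.
  rewrite /W /W' !(mulmxDl, mulmxDr, mulmx1, mul1mx) mul_shift_tr -scalemxAr.
  rewrite shift_delta /y2.
  move: (shift_mx _ _) (delta_mx ord_max _) (delta_mx 1 0) (delta_mx 2 0).
  by move=> A B C D; apply/matrixP => i j; rewrite !mxE; ring.
have Qy3 : Q y3 y3.
  suff -> : y3 = (W + W') - 2%:R *: 1%:M by apply: QB => //; apply: QZ.
  rewrite /W /W' /y3 /path_mx; move: (shift_mx _ _) (delta_mx 2 0).
  by move=> A B; apply/matrixP => i j; rewrite !mxE; ring.
have Q00 : Q (delta_mx 0 0) (delta_mx 0 0).
  suff <- : y1 *m y1 = delta_mx 0 0 by apply: QM.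
  rewrite mulmxBl !mulmxBr -!scalemxAl -!scalemxAr.
  by rewrite mul_delta_mx !mul_delta_mx_0 // !scaler0 !subr0.
have Q0 : Q 0 0 by rewrite -(scale0r (1%:M)); apply: QZ.
have Qeps10 : Q (eps *: delta_mx 1 0) (eps *: delta_mx 1 0).
  have -> : eps *: delta_mx 1 0 = y2 *m y2 - y2; last by apply: QB => //;
    apply: QM.
  rewrite mulmxBl !mulmxBr -!scalemxAl -!scalemxAr.
  rewrite mul_delta_mx !mul_delta_mx_0 // !scaler0 !subr0.
  by rewrite opprB addrC subrK.
have Qeps21 : Q (eps *: delta_mx 2 1) (eps *: delta_mx 2 1).
  have -> : eps *: delta_mx 2 1 = delta_mx 0 0 - y1; last exact: QB.
  by rewrite opprB addrC subrK.
have Qeps20 : Q (eps *: delta_mx 2 0) 0 /\ Q 0 (eps *: delta_mx 2 0).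
  have ee : eps * eps = eps by case: sym; rewrite ?mulr0 ?mulr1.
  have := QM Qeps21 Qeps10; have := QM Qeps10 Qeps21.
  rewrite -!scalemxAl -!scalemxAr !scalerA ee mul_delta_mx mul_delta_mx_0 //.
  by rewrite scaler0.
have Qpath : Q (path_mx K n.+3) (path_mx K n.+3).
  have -> : path_mx K n.+3
    = y3 - (eps *: delta_mx 2 0 + 0) by rewrite addr0 addrK.
  apply: QB => //; rewrite {2}[_ + 0]addrC.
  by apply: QD; case: Qeps20.
have Qtr Y : Q Y Y^T.
  apply: (path_mx_generates (S := fun Z => Q Z Z^T)) => [A B|a A|A B||].
  - by rewrite linearD; apply: QD.
  - by rewrite linearZ; apply: QZ.
  - by rewrite trmx_mul; apply: QM.
  - by rewrite trmx_delta.
  - by rewrite /path_mx linearD /= trmxK [X in Q _ X]addrC.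
case: sym Qeps10 => [_ ->|/= Q10 _] //; rewrite scale1r in Q10.
have Q10' : Q (delta_mx 1 0) 0.
  by have := QM Q10 Q00; rewrite mul_delta_mx mul_delta_mx_0.
have Ql Y : Q Y 0.
  rewrite [Y]matrix_sum_delta; elim/big_ind: _ => // [A B QA QB'|i _].
    by rewrite -[0]addr0; apply: QD.
  elim/big_ind: _ => // [A B QA QB'|j _]; first by rewrite -[0]addr0; apply: QD.
  rewrite -(scaler0 _ (Y i j)); apply: QZ.
  have := QM (QM (Qtr (delta_mx i 1)) Q10') (Qtr (delta_mx 0 j)).
  by rewrite mul0mx mulmx0 !mul_delta_mx.
have := QD (Ql (X - X'^T)) (Qtr X'^T).
by rewrite trmxK subrK add0r.
Qed.
End PairAlgebra.

(** * Root vectors in four by four blocks *)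

Section BlockUnits.
Variables (K : comNzRingType) (k : nat).

(** The inclusion of the i-th of four blocks of size k; every i > 2 denotes the
    last block. *)
Definition blk (i : nat) : 'M[K]_((k + k) + (k + k), k) :=
  match i with
  | 0 => col_mx (col_mx 1%:M 0) 0
  | 1 => col_mx (col_mx 0 1%:M) 0
  | 2 => col_mx 0 (col_mx 1%:M 0)
  | _ => col_mx 0 (col_mx 0 1%:M)
  end.

(** The matrix with block X in position (i, j): products of such matrices are
    governed by the indices, as for matrix units. *)
Definition bunit i j (X : 'M[K]_k) := blk i *m X *m (blk j)^T.

Lemma blk_id i : (blk i)^T *m blk i = 1%:M.
Proof.
by case: i => [|[|[|i]]]; rewrite !(tr_col_mx, mul_row_col, trmx0, trmx1);
  rewrite !(mul0mx, mulmx0, mul1mx, addr0, add0r).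
Qed.

Lemma blk_ortho i j : (i < 4)%N -> (j < 4)%N -> i != j ->
  (blk i)^T *m blk j = 0.
Proof.
by case: i j => [|[|[|[|i]]]] [|[|[|[|j]]]] // _ _ _;
  rewrite !(tr_col_mx, mul_row_col, trmx0, trmx1);
  rewrite !(mul0mx, mulmx0, mul1mx, addr0, add0r).
Qed.

Lemma bunitM i j l X Y : bunit i j X *m bunit j l Y = bunit i l (X *m Y).
Proof.
by rewrite /bunit !mulmxA -(mulmxA _ (blk j)^T) blk_id mulmx1 -!mulmxA.
Qed.

Lemma bunitM0 i j j' l X Y : (j < 4)%N -> (j' < 4)%N -> j != j' ->
  bunit i j X *m bunit j' l Y = 0.
Proof.
move=> j4 j'4 jj'; rewrite /bunit !mulmxA -(mulmxA _ (blk j)^T).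
by rewrite blk_ortho // mulmx0 !mul0mx.
Qed.

Lemma bunitD i j X Y : bunit i j (X + Y) = bunit i j X + bunit i j Y.
Proof. by rewrite /bunit mulmxDr mulmxDl. Qed.

Lemma bunitZ i j a X : bunit i j (a *: X) = a *: bunit i j X.
Proof. by rewrite /bunit -scalemxAr -scalemxAl. Qed.

Lemma bunitN i j X : bunit i j (- X) = - bunit i j X.
Proof. by rewrite -scaleN1r bunitZ scaleN1r. Qed.

Lemma bunit_block4 a11 a12 a13 a14 a21 a22 a23 a24
                   a31 a32 a33 a34 a41 a42 a43 a44 :
  block_mx (block_mx a11 a12 a21 a22) (block_mx a13 a14 a23 a24)
           (block_mx a31 a32 a41 a42) (block_mx a33 a34 a43 a44) =
  bunit 0 0 a11 + bunit 0 1 a12 + bunit 0 2 a13 + bunit 0 3 a14 +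
  (bunit 1 0 a21 + bunit 1 1 a22 + bunit 1 2 a23 + bunit 1 3 a24) +
  (bunit 2 0 a31 + bunit 2 1 a32 + bunit 2 2 a33 + bunit 2 3 a34) +
  (bunit 3 0 a41 + bunit 3 1 a42 + bunit 3 2 a43 + bunit 3 3 a44).
Proof.
rewrite /bunit /= !tr_col_mx !trmx1 !trmx0 -!mulmxA !mul_mx_row !mulmx0 !mulmx1.
rewrite !add_row_mx !(addr0, add0r) !mul_col_mx !(mul0mx, mul1mx).
do 2!rewrite ?add_row_mx ?(addr0, add0r).
do 3!rewrite ?add_col_mx ?(addr0, add0r).
rewrite (block_mxEh (block_mx _ _ _ _)).
by rewrite !(block_mxEh _ a12) !(block_mxEh _ a14) !(block_mxEh _ a32)
  !(block_mxEh _ a34) -!block_mxEv !block_mxEh.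
Qed.

(** The short roots of type C_2, in a version where the two blocks of a short
    root vector may be chosen independently.  Up to signs, V_a and V_b belong to
    the roots a = e1 + e2 and b = e2 - e1, and V_c belongs to the long root - 2
    e2, so that the three roots have sum 0; na and nb are the opposites of a and
    b.  The long root vectors 2 e1, - 2 e1, 2 e2, - 2 e2 are the block units in
    positions (0, 2), (2, 0), (1, 3), (3, 1). *)
Definition short_a X X' := bunit 0 3 X + bunit 1 2 X'.
Definition short_na X X' := bunit 3 0 X + bunit 2 1 X'.
Definition short_b X X' := bunit 1 0 X - bunit 2 3 X'.
Definition short_nb X X' := bunit 0 1 X - bunit 3 2 X'.
End BlockUnits.

Ltac bsimpl :=
  rewrite /short_a /short_na /short_b /short_nb
    ?(mulmxDl, mulmxDr, mulmxBl, mulmxBr, mulNmx, mulmxN) ?bunitM ?bunitM0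
    ?mul0mx ?mulmx0 ?oppr0 ?addr0 ?add0r ?sub0r //.

Section Roots.
Variables (K : fieldType) (k : nat).
Variable P : 'M[K]_((k + k) + (k + k)) -> Prop.
Hypothesis nz2 : 2%:R != 0 :> K.
Hypothesis PM : forall X Y, P X -> P Y -> P (X *m Y).
Local Notation E := (@bunit K k).
Implicit Types X Y Z : 'M[K]_k.

Lemma root_in_eqN (N M : 'M[K]_((k + k) + (k + k))) :
  root_in P N -> M = - N -> root_in P M.
Proof. by move=> PN ->; apply: root_inN. Qed.

(** For root vectors N and M, the bracket NM - MN lies in the root space of the
    sum r + s of their roots.  When r is short and s is long, NMN lies in that
    of 2 r + s; both are then obtained from one family of commutators.  For the
    short roots a and b, NMN vanishes. *)
Lemma root_in_comm_a_b X X' Z Z' :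
  root_in P (short_a X X') -> root_in P (short_b Z Z') ->
  root_in P (E 1 3 (Z *m X + X' *m Z')).
Proof.
move=> PN PM'.
have [] := root_in_commutator PM nz2 _ _ _ PN PM'; bsimpl.
by move=> /root_in_eqN + _; apply; rewrite bunitD opprB opprK.
Qed.

Lemma root_in_comm_a_31 X X' Y :
  root_in P (short_a X X') -> root_in P (E 3 1 Y) ->
  root_in P (short_nb (X *m Y) (Y *m X')) /\ root_in P (E 0 2 (X *m Y *m X')).
Proof.
move=> PN PM'.
by have [] := root_in_commutator PM nz2 _ _ _ PN PM'; bsimpl.
Qed.

Lemma root_in_comm_b_31 X X' Y :
  root_in P (short_b X X') -> root_in P (E 3 1 Y) ->
  root_in P (short_na (Y *m X) (X' *m Y)) /\ root_in P (E 2 0 (X' *m Y *m X)).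
Proof.
move=> PN PM'.
have [] := root_in_commutator PM nz2 _ _ _ PN PM'; bsimpl.
move=> /root_in_eqN Ps /root_in_eqN Pl; split; [apply: Ps|apply: Pl].
  by rewrite opprD opprK addrC opprK.
by rewrite opprK.
Qed.

Lemma root_in_comm_b_02 X X' Y :
  root_in P (short_b X X') -> root_in P (E 0 2 Y) ->
  root_in P (E 1 3 (X *m Y *m X')).
Proof.
move=> PN PM'.
have [] := root_in_commutator PM nz2 _ _ _ PN PM'; bsimpl.
by move=> _ /root_in_eqN; apply; rewrite opprK.
Qed.

Lemma root_in_comm_a_20 X X' Y :
  root_in P (short_a X X') -> root_in P (E 2 0 Y) ->
  root_in P (short_b (X' *m Y) (Y *m X)) /\ root_in P (E 1 3 (X' *m Y *m X)).
Proof.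
move=> PN PM'.
by have [] := root_in_commutator PM nz2 _ _ _ PN PM'; bsimpl.
Qed.

Lemma root_in_comm_nb_13 X X' Y :
  root_in P (short_nb X X') -> root_in P (E 1 3 Y) ->
  root_in P (short_a (X *m Y) (Y *m X')).
Proof.
move=> PN PM'.
have [] := root_in_commutator PM nz2 _ _ _ PN PM'; bsimpl.
by rewrite opprK.
Qed.

Lemma root_in_comm_na_02 X X' Y :
  root_in P (short_na X X') -> root_in P (E 0 2 Y) ->
  root_in P (E 3 1 (X *m Y *m X')).
Proof.
move=> PN PM'.
by have [] := root_in_commutator PM nz2 _ _ _ PN PM'; bsimpl.
Qed.

End Roots.

(** * Reaching all root subgroups *)

Section Generation.
Variables (K : fieldType) (n : nat) (sym : bool).
Local Notation k := n.+3.
Variable P : 'M[K]_((k + k) + (k + k)) -> Prop.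
Hypothesis nz2 : 2%:R != 0 :> K.
Hypothesis PM : forall X Y, P X -> P Y -> P (X *m Y).
Local Notation E := (@bunit K k).

Variables al be : 'M[K]_k.
Hypothesis al_unit : al \in unitmx.
Hypothesis be_unit : be \in unitmx.
Hypothesis al_be : al *m be = 1%:M + shift_mx K k.
Hypothesis be_al :
  be *m al = 1%:M + ((shift_mx K k)^T + (~~ sym)%:R *: delta_mx 2 0).
Hypothesis al_sym : sym -> al^T = al.
Hypothesis be_sym : sym -> be^T = be.
Hypothesis Pa : root_in P (short_a al al).
Hypothesis Pb : root_in P (short_b be be).
Hypothesis Pc : root_in P (E 3 1 1%:M).

(** The pairs that occur as blocks of short root vectors: all of them for the
    special linear group, only (X, X^T) for the symplectic group. *)
Definition paired (X X' : 'M[K]_k) := sym -> X' = X^T.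

Lemma root_in_short_aD X X' Y Y' :
  root_in P (short_a X X') -> root_in P (short_a Y Y') ->
  root_in P (short_a (X + Y) (X' + Y')).
Proof.
move=> PX PY.
have -> : short_a (X + Y) (X' + Y') = short_a X X' + short_a Y Y'.
  by rewrite /short_a !bunitD addrACA.
by apply: root_inD => //; bsimpl.
Qed.

Lemma root_in_short_aZ a X X' :
  root_in P (short_a X X') -> root_in P (short_a (a *: X) (a *: X')).
Proof. by rewrite /short_a !bunitZ -scalerDr; apply: root_inZ. Qed.

(** Going from the root a to - b with the unit matrix at - 2 e2, and back to a
    with Y at 2 e2. *)
Lemma short_a_absorb X X' Y : root_in P (short_a X X') -> root_in P (E 1 3 Y) ->
  root_in P (short_a (X *m Y) (Y *m X')).
Proof.
move=> PX PY; have [+ _] := root_in_comm_a_31 nz2 PM PX Pc.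
by rewrite mulmx1 mul1mx => /(root_in_comm_nb_13 nz2 PM)/(_ PY).
Qed.

Lemma root_in_13_trace : root_in P (E 1 3 (be *m al + al *m be)).
Proof. exact: (root_in_comm_a_b nz2 PM Pa Pb). Qed.

Lemma root_in_20_sq : root_in P (E 2 0 (be *m be)).
Proof. by have [_] := root_in_comm_b_31 nz2 PM Pb Pc; rewrite mulmx1. Qed.

Lemma root_in_13_ba : root_in P (E 1 3 ((be *m al) *m (al *m be))).
Proof.
have [_] := root_in_comm_a_31 nz2 PM Pa Pc;
  rewrite mulmx1 => /(root_in_comm_b_02 nz2 PM Pb).
by rewrite !mulmxA.
Qed.

Lemma root_in_13_ab : root_in P (E 1 3 ((al *m be) *m (be *m al))).
Proof.
by have [_] := root_in_comm_a_20 nz2 PM Pa root_in_20_sq; rewrite !mulmxA.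
Qed.

(** The pairs Z that can be absorbed on the right of (al Y, Y' al) form an
    algebra of pairs containing (Y, Y) for every Y in the root space of 2 e2;
    the three available such Y generate it.  It then suffices to write X as al
    Z, starting from (al, al). *)
Lemma short_a_all X X' : paired X X' -> root_in P (short_a X X').
Proof.
pose T Z Z' := forall Y Y', root_in P (short_a (al *m Y) (Y' *m al)) ->
  root_in P (short_a (al *m (Y *m Z)) ((Z' *m Y') *m al)).
have T13 Z : root_in P (E 1 3 Z) -> T Z Z.
  by move=> PZ Y Y' /short_a_absorb/(_ PZ); rewrite !mulmxA.
have Tall Z Z' : paired Z Z' -> T Z Z'.
  apply: (pair_algebra (Q :=
    T)) => [A A' B B' TA TB|a A A' TA|A A' B B' TA TB||||].
  - move=> Y Y' PY; rewrite !(mulmxDr, mulmxDl).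
    by apply: root_in_short_aD; [apply: TA | apply: TB].
  - move=> Y Y' PY; rewrite -!(scalemxAl, scalemxAr).
    by apply: root_in_short_aZ; apply: TA.
  - by move=> Y Y' /TA/TB; rewrite !mulmxA.
  - by move=> Y Y'; rewrite mulmx1 mul1mx.
  - by rewrite -be_al -al_be addrC; apply/T13/root_in_13_trace.
  - by rewrite -be_al -al_be; apply/T13/root_in_13_ba.
  - by rewrite -be_al -al_be; apply/T13/root_in_13_ab.
move=> XX'; have := Tall (invmx al *m X) (X' *m invmx al) _ 1%:M 1%:M.
rewrite mulmx1 !mul1mx mulmx1 mulKVmx // mulmxKV //; apply=> //.
by move=> s; rewrite XX' // trmx_mul trmx_inv al_sym.
Qed.

Lemma short_b_all X X' : paired X X' -> root_in P (short_b X X').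
Proof.
move=> XX'; pose b2 := be *m be.
have b2U : b2 \in unitmx by rewrite unitmx_mul be_unit.
have pX : paired (invmx b2 *m X') (X *m invmx b2).
  by move=> s; rewrite XX' // !trmx_mul trmxK trmx_inv trmx_mul be_sym.
have [+ _] := root_in_comm_a_20 nz2 PM (short_a_all pX) root_in_20_sq.
by rewrite mulmxKV // mulKVmx.
Qed.

Lemma short_na_all X X' : paired X X' -> root_in P (short_na X X').
Proof.
move=> /short_b_all PX; have [+ _] := root_in_comm_b_31 nz2 PM PX Pc.
by rewrite mulmx1 mul1mx.
Qed.

(** Products X X' with X = X' = Z + 1, Z and 1, where Z = Y / 2, combine to 2 Z
    = Y. *)
Lemma root_in_polarize i j (f : 'M[K]_k -> 'M[K]_k -> 'M[K]_k) :
    i != j -> (i < 4)%N -> (j < 4)%N -> 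
    (forall X X', paired X X' -> root_in P (E i j (f X X'))) ->
    (f = (fun X X' => X *m X') \/ f = (fun X X' => X' *m X)) ->
  forall Y, (sym -> Y^T = Y) -> root_in P (E i j Y).
Proof.
move=> ij i4 j4 Pf fE Y Ysym; pose Z := 2%:R^-1 *: Y.
have ZZ : paired Z Z by move=> s; rewrite /Z linearZ /= Ysym.
have p1 : paired 1%:M 1%:M by move=> s; rewrite trmx1.
have pZ1 : paired (Z + 1%:M) (Z + 1%:M).
  by move=> s; rewrite linearD /= trmx1 -ZZ.
have -> : E i j Y = E i j (f (Z + 1%:M) (Z + 1%:M))
  + (- E i j (f Z Z) - E i j (f 1%:M 1%:M)).
  rewrite -!bunitN -!bunitD; congr (bunit _ _ _).
  by case: fE => ->; rewrite mulmxDl !mulmxDr !mulmx1 mul1mx /Z;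
    move: (_ *m _) => Q; apply/matrixP => u v; rewrite !mxE; field.
have EE X1 X2 : E i j X1 *m E i j X2 = 0 by rewrite bunitM0 // eq_sym.
apply: root_inD; rewrite ?(mulmxDr, mulmxN, EE, oppr0, addr0) //.
  exact: Pf.
apply: root_inD; rewrite ?(mulNmx, mulmxN, EE, oppr0) //.
  by apply: root_inN; apply: Pf.
by apply: root_inN; apply: Pf.
Qed.

Lemma root_in_02_all Y : (sym -> Y^T = Y) -> root_in P (E 0 2 Y).
Proof.
apply: root_in_polarize (or_introl erefl) _ => // X X' /short_a_all PX.
by have [_] := root_in_comm_a_31 nz2 PM PX Pc; rewrite mulmx1.
Qed.

Lemma root_in_13_all Y : (sym -> Y^T = Y) -> root_in P (E 1 3 Y).
Proof.
apply: root_in_polarize (or_introl erefl) _ => // X X' /short_b_all PX.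
have P1 : root_in P (E 0 2 1%:M) by apply: root_in_02_all; rewrite trmx1.
by have := root_in_comm_b_02 nz2 PM PX P1; rewrite mulmx1.
Qed.

Lemma root_in_20_all Y : (sym -> Y^T = Y) -> root_in P (E 2 0 Y).
Proof.
apply: root_in_polarize (or_intror erefl) _ => // X X' /short_b_all PX.
by have [_] := root_in_comm_b_31 nz2 PM PX Pc; rewrite mulmx1.
Qed.

Lemma root_in_31_all Y : (sym -> Y^T = Y) -> root_in P (E 3 1 Y).
Proof.
apply: root_in_polarize (or_introl erefl) _ => // X X' /short_na_all PX.
have P1 : root_in P (E 0 2 1%:M) by apply: root_in_02_all; rewrite trmx1.
by have := root_in_comm_na_02 nz2 PM PX P1; rewrite mulmx1.
Qed.

Lemma upper_all (B : 'M[K]_(k + k)) : (sym -> B^T = B) ->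
  P (block_mx 1%:M B 0 1%:M).
Proof.
rewrite -[B]submxK.
move: (ulsubmx B) (ursubmx B) (dlsubmx B) (drsubmx B) => B1 B2 B3 B4 Bsym.
have {Bsym} [s1 s2 s4] : [/\ sym -> B1^T = B1, paired B2 B3 & sym -> B4^T = B4].
  by split=> s; have := Bsym s; rewrite tr_block_mx => /eq_block_mx[].
rewrite -block_mx_ur1; apply: root_in1.
have -> : block_mx 0 (block_mx B1 B2 B3 B4) 0 0
  = E 0 2 B1 + (short_a B2 B3 + E 1 3 B4).
  by rewrite -!block_mx0 bunit_block4 /bunit !(mulmx0, mul0mx, addr0, add0r)
    !addrA.
apply: root_inD => //; first by bsimpl.
  exact: root_in_02_all.
apply: root_inD => //; first by bsimpl.
  exact: short_a_all.
exact: root_in_13_all.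
Qed.

Lemma lower_all (B : 'M[K]_(k + k)) : (sym -> B^T = B) ->
  P (block_mx 1%:M 0 B 1%:M).
Proof.
rewrite -[B]submxK.
move: (ulsubmx B) (ursubmx B) (dlsubmx B) (drsubmx B) => B1 B2 B3 B4 Bsym.
have {Bsym} [s1 s2 s4] : [/\ sym -> B1^T = B1, paired B3 B2 & sym -> B4^T = B4].
  by split=> s; have := Bsym s; rewrite tr_block_mx => /eq_block_mx[].
rewrite -block_mx_dl1; apply: root_in1.
have -> : block_mx 0 0 (block_mx B1 B2 B3 B4) 0
  = E 2 0 B1 + (short_na B3 B2 + E 3 1 B4).
  rewrite -!block_mx0 bunit_block4 /short_na /bunit.
  rewrite !(mulmx0, mul0mx, addr0, add0r) !addrA.
  by congr (_ + _); rewrite addrAC.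
apply: root_inD => //; first by bsimpl.
  exact: root_in_20_all.
apply: root_inD => //; first by bsimpl.
  exact: short_na_all.
exact: root_in_31_all.
Qed.

End Generation.

(** * The choice of the matrices *)

(** The matrices M_a = alpha and M_b = beta, to be used with M_c = 1, are chosen
    so that alpha beta = 1 + N and beta alpha = 1 + N^T + eps e_20, where N is
    the shift.  A matrix and its transpose are conjugate by a symmetric matrix,
    here the flip; for eps = 0 this makes alpha and beta symmetric.  For eps = 1
    they are twisted by the elementary matrix 1 + e_10, which conjugates N^T to
    N^T + e_20. *)
Section AlphaBeta.
Variables (S : comNzRingType) (n : nat) (sym : bool).
Local Notation k := n.+3.
Local Notation N := (shift_mx S k).
Local Notation d10 := (delta_mx 1 0 : 'M[S]_k).
Local Notation eps := ((~~ sym)%:R : S).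

Definition flip_mx : 'M[S]_k := perm_mx (perm (@rev_ord_inj k)).

Lemma flipK : flip_mx *m flip_mx = 1%:M.
Proof.
rewrite -perm_mxM (_ : (_ * _)%g = 1%g) ?perm_mx1 //.
by apply/permP => i; rewrite permM !permE rev_ordK.
Qed.

Lemma tr_flip : flip_mx^T = flip_mx.
Proof.
rewrite tr_perm_mx; congr perm_mx; apply/permP => i.
by apply: (@perm_inj _ (perm (@rev_ord_inj k))); rewrite permKV !permE rev_ordK.
Qed.

Lemma flip_shift : flip_mx *m N *m flip_mx = N^T.
Proof.
rewrite -row_permE -[in X in _ *m X]tr_flip tr_perm_mx -col_permE.
apply/matrixP => i j; rewrite !mxE !permE /=; congr (_%:R).
by have := ltn_ord i; have := ltn_ord j; lia.
Qed.

Definition alpha : 'M[S]_k := (1%:M + N) *m flip_mx *m (1%:M + eps *: d10).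
Definition beta : 'M[S]_k := (1%:M - eps *: d10) *m flip_mx.

Let d10d10 : d10 *m d10 = 0. Proof. by rewrite mul_delta_mx_0. Qed.

Lemma alpha_beta : alpha *m beta = 1%:M + N.
Proof.
have dd : (1%:M + eps *: d10) *m (1%:M - eps *: d10) = 1%:M.
  rewrite mulmxDl !mulmxDr !mulmx1 mul1mx mulmxN -scalemxAl -scalemxAr d10d10.
  by rewrite !scaler0 subr0 subrK.
rewrite /alpha /beta mulmxA -(mulmxA (_ *m flip_mx)) dd mulmx1.
by rewrite -mulmxA flipK mulmx1.
Qed.

Lemma beta_alpha : beta *m alpha = 1%:M + (N^T + eps *: delta_mx 2 0).
Proof.
have dNT : d10 *m N^T = 0.
  by apply/matrixP => u v; rewrite mul_delta_mxE !mxE mulr0.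
have NTd : N^T *m d10 = delta_mx 2 0.
  apply: trmx_inj; rewrite trmx_mul trmxK !trmx_delta.
  apply/matrixP => u v; rewrite mul_delta_mxE !mxE -natrM mulnb.
  by congr ((_ && _)%:R); rewrite eq_sym.
have -> : beta *m alpha
  = (1%:M - eps *: d10) *m (1%:M + N^T) *m (1%:M + eps *: d10).
  have fWf : flip_mx *m (1%:M + N) *m flip_mx = 1%:M + N^T.
    by rewrite mulmxDr mulmx1 mulmxDl flipK flip_shift.
  by rewrite -fWf /alpha /beta !mulmxA.
rewrite !(mulmxDl, mulmxDr, mulmx1, mul1mx, mulNmx).
rewrite -!scalemxAl -!scalemxAr dNT NTd d10d10 mul0mx !scaler0 !oppr0 !addr0.
move: (N^T) d10 (delta_mx 2 0) => A B C; apply/matrixP => i j; rewrite !mxE;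
  ring.
Qed.

Lemma alpha_sym : sym -> alpha^T = alpha.
Proof.
rewrite /alpha => ->;
  rewrite scale0r addr0 mulmx1 trmx_mul tr_flip linearD /= trmx1.
by rewrite -flip_shift mulmxDr mulmx1 !mulmxA flipK mul1mx mulmxDl mul1mx.
Qed.

Lemma beta_sym : sym -> beta^T = beta.
Proof. by rewrite /beta => ->; rewrite scale0r subr0 mul1mx tr_flip. Qed.

End AlphaBeta.

Lemma map_shift (S S' : comNzRingType) (f : {rmorphism S -> S'}) n :
  map_mx f (shift_mx S n) = shift_mx S' n.
Proof. by apply/matrixP => i j; rewrite !mxE rmorph_nat. Qed.

Lemma det_shift1 (S : comNzRingType) n : \det (1%:M + shift_mx S n) = 1.
Proof.
rewrite -det_tr det_trig.
  by rewrite big1 // => i _; rewrite !mxE eqxx; case: eqP => [|_];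
    [lia | rewrite addr0].
apply/is_trig_mxP => i j ij; rewrite !mxE.
have -> : (j == i) = false by apply/eqP => ji; move: ij; rewrite ji ltnn.
by case: eqP => [/= ji|_]; [move: ij; rewrite -ji; lia | rewrite addr0].
Qed.

Lemma map_bunit (S S' : comNzRingType) (f : {rmorphism S -> S'}) k i j (X :
  'M[S]_k) :
  map_mx f (bunit i j X) = bunit i j (map_mx f X).
Proof.
rewrite /bunit !map_mxM -map_trmx; congr (_ *m _ *m _^T).
  by case: i => [|[|[|i]]]; rewrite /= !map_col_mx map_mx1 !map_mx0.
by case: j => [|[|[|j]]]; rewrite /= !map_col_mx map_mx1 !map_mx0.
Qed.

Section Serre.
Variables (S : comNzRingType) (m : nat) (X Y : 'M[S]_m).
Hypothesis XX : X *m X = 0.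

Lemma iter_br2 : X *m Y *m X = 0 -> iter 2 (mx_br X) Y = 0.
Proof.
move=> XYX; rewrite /= /mx_br mulmxBr mulmxBl !mulmxA XX XYX.
by rewrite -(mulmxA Y) XX mulmx0 mul0mx !subr0.
Qed.

Lemma iter_br3 : iter 3 (mx_br X) Y = 0.
Proof.
rewrite /= /mx_br !(mulmxBr, mulmxBl) !mulmxA XX.
have XXr Z : Z *m X *m X = 0 by rewrite -mulmxA XX mulmx0.
by rewrite ?XXr ?mul0mx ?XXr ?sub0r ?subr0 ?mulNmx ?XXr !(oppr0, subr0, subrr).
Qed.
End Serre.

Section Nilpotent.
Variables (S : comNzRingType) (k : nat) (Ma Mb Mc : 'M[S]_k).

(** The images of the generators e_a, e_b, e_c. *)
Definition root_mx (i : 'I_3) : 'M[S]_((k + k) + (k + k)) :=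
  match val i with
  | 0 => short_a Ma Ma
  | 1 => short_b Mb Mb
  | _ => bunit 3 1 Mc
  end.

Lemma root_mx_sq i : root_mx i *m root_mx i = 0.
Proof. by case: i => -[|[|[|]]] //= lti; rewrite /root_mx /=; bsimpl. Qed.

Lemma HB22_exponent (i j : 'I_3) : i != j ->
  `|1 - HB22 i j|%N = if j == ic then 3%N else 2%N.
Proof.
by case: i j => -[|[|[|]]] //= lti [[|[|[|]]]] //= ltj _; rewrite mxE.
Qed.

Lemma root_mx_triple i j : i != j -> j != ic ->
  root_mx i *m root_mx j *m root_mx i = 0.
Proof.
case: i j => -[|[|[|]]] //= lti [[|[|[|]]]] //= ltj _ _; rewrite /root_mx /=;
  bsimpl.
Qed.

Lemma root_mx_serre i j : i != j ->
  iter `|1 - HB22 i j|%N (mx_br (root_mx i)) (root_mx j) = 0.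
Proof.
move=> ij; rewrite HB22_exponent //; case: ifPn => jc.
  by apply: iter_br3; apply: root_mx_sq.
by apply: iter_br2; [apply: root_mx_sq | apply: root_mx_triple].
Qed.

End Nilpotent.

(** * Surjectivity *)

Lemma two_neq0 (F : finFieldType) (p r : nat) :
  prime p -> (2 < p)%N -> #|F| = (p ^ r)%N -> 2%:R != 0 :> F.
Proof.
move=> p_prime p_gt2 cardF.
have charF := card_finPcharP cardF p_prime.
by rewrite -(dvdn_pcharf charF) gtnNdvd.
Qed.

Section VMatrices.
Variables (K : fieldType) (k : nat).
Implicit Type M : 'M[K]_k.

Lemma one_bunit : 1%:M = bunit 0 0 1%:M + bunit 1 1 1%:M + bunit 2 2 1%:M
  + bunit 3 3 1%:M :> 'M[K]_((k + k) + (k + k)).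
Proof.
rewrite !scalar_mx_block -!block_mx0 bunit_block4.
by rewrite /bunit !(mulmx0, mul0mx, addr0, add0r).
Qed.

Lemma Va_root M l : Va M l = 1%:M + l *: short_a M M.
Proof.
rewrite /Va /block4 bunit_block4 one_bunit /short_a scalerDr -!bunitZ.
rewrite /bunit !(mulmx0, mul0mx, addr0, add0r).
by apply/matrixP => i j; rewrite !mxE; ring.
Qed.

Lemma Vb_root M l : Vb M l = 1%:M + l *: short_b M M.
Proof.
rewrite /Vb /block4 bunit_block4 one_bunit /short_b scalerBr -!bunitZ -bunitN.
rewrite /bunit !(mulmx0, mul0mx, addr0, add0r).
by apply/matrixP => i j; rewrite !mxE; ring.
Qed.

Lemma Vc_root M l : Vc M l = 1%:M + l *: bunit 3 1 M.
Proof.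
rewrite /Vc /block4 bunit_block4 one_bunit -!bunitZ.
rewrite /bunit !(mulmx0, mul0mx, addr0, add0r).
by apply/matrixP => i j; rewrite !mxE; ring.
Qed.

Lemma det_Va M l : \det (Va M l) = 1.
Proof. by rewrite /Va /block4 -!scalar_mx_block block_mx0 det_ublock !det1
  mulr1. Qed.

Lemma det_Vb M l : \det (Vb M l) = 1.
Proof. by rewrite /Vb /block4 !block_mx0 det_ublock det_lblock det_ublock
  !det1 !mulr1. Qed.

Lemma det_Vc M l : \det (Vc M l) = 1.
Proof. by rewrite /Vc /block4 -!scalar_mx_block block_mx0 det_lblock !det1
  mulr1. Qed.

Lemma symplectic_Va M l : M^T = M -> symplectic (Va M l).
Proof.
move=> MT; rewrite /Va /block4 -!scalar_mx_block block_mx0.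
by apply: symplectic_ur; rewrite tr_block_mx !trmx0 linearZ /= MT.
Qed.

Lemma symplectic_Vc M l : M^T = M -> symplectic (Vc M l).
Proof.
move=> MT; rewrite /Vc /block4 -!scalar_mx_block block_mx0.
by apply: symplectic_dl; rewrite tr_block_mx !trmx0 linearZ /= MT.
Qed.

Lemma symplectic_Vb M l : M^T = M -> symplectic (Vb M l).
Proof.
move=> MT; rewrite /Vb /block4 !block_mx0.
set g := block_mx 1%:M 0 _ _.
set h := block_mx 1%:M _ 0 _.
have gh : g^T *m h = 1%:M.
  rewrite /g /h tr_block_mx mulmx_block !trmx1 trmx0 linearZ /= MT.
  rewrite !(mulmx0, mul0mx, mulmx1, mul1mx, addr0, add0r) addNr.
  by rewrite -scalar_mx_block.
have gTU : g^T \in unitmx by case/mulmx1_unit: gh.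
have -> : h = invmx g^T by rewrite -[LHS]mul1mx -(mulVmx gTU) -mulmxA gh mulmx1.
by apply: symplectic_diag; rewrite -unitmx_tr.
Qed.

End VMatrices.

Section Realization.
Variables (R : realType) (n : nat) (F : fieldType) (sym : bool).
Local Notation k := n.+3.
Hypothesis nz2 : 2%:R != 0 :> F.

Let al : 'M[F]_k := map_mx intr (alpha int n sym).
Let be : 'M[F]_k := map_mx intr (beta int n sym).

(** Although M_a and M_b have entries in the prime field, the image contains whole
    root subgroups over F, since l ranges over F in x_i(l). *)
Lemma Phi_unipotent_blocks : exists (Ma Mb : 'M[F]_k)
    (f : Uplus R HB22 F -> 'M[F]_((k + k) + (k + k))),
  [/\ Ma \in unitmx, Mb \in unitmx, sym -> Ma^T = Ma & sym -> Mb^T = Mb] /\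
  [/\ f 1%g = 1%:M, {morph f : x y / (x * y)%g >-> x *m y},
      (forall l, [/\ f (xroot R HB22 ia l) = Va Ma l,
                     f (xroot R HB22 ib l) = Vb Mb l &
                     f (xroot R HB22 ic l) = Vc 1%:M l]),
      (forall B, (sym -> B^T = B) -> exists u, f u = block_mx 1%:M B 0 1%:M) &
      (forall B, (sym -> B^T = B) -> exists u, f u = block_mx 1%:M 0 B 1%:M)].
Proof.
pose N := root_mx (alpha int n sym) (beta int n sym) 1%:M.
have [f [f1 fM fx]] := Uplus_hom R F (root_mx_sq _ _ _) (root_mx_serre _ _ _) : 
  exists f : Uplus R HB22 F -> 'M[F]_((k + k) + (k + k)), 
  [/\ f 1%g = 1%:M, {morph f : x y / (x * y)%g >-> x *m y} &
      forall i l, f (xroot R HB22 i l) = 1%:M + l *: map_mx intr (N i)].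
have fa l : f (xroot R HB22 ia l) = Va al l.
  by rewrite fx Va_root /N /root_mx /= /short_a map_mxD !map_bunit.
have fb l : f (xroot R HB22 ib l) = Vb be l.
  by rewrite fx Vb_root /N /root_mx /= /short_b map_mxB !map_bunit.
have fc l : f (xroot R HB22 ic l) = Vc 1%:M l.
  by rewrite fx Vc_root /N /root_mx /= map_bunit map_mx1.
have al_be : al *m be = 1%:M + shift_mx F k.
  by rewrite -map_mxM alpha_beta map_mxD map_mx1 map_shift.
have be_al : be *m al = 1%:M + ((shift_mx F k)^T + (~~ sym)%:R *: delta_mx 2 0).
  rewrite -map_mxM beta_alpha !map_mxD map_mx1 -map_trmx map_shift map_mxZ.
  by rewrite map_delta_mx rmorph_nat.
have U : (al \in unitmx) && (be \in unitmx).
  by rewrite -unitmx_mul al_be unitmxE det_shift1 unitr1.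
have [alU beU] := andP U.
have als : sym -> al^T = al by move=> s; rewrite map_trmx alpha_sym.
have bes : sym -> be^T = be by move=> s; rewrite map_trmx beta_sym.
pose P X := exists u, f u = X.
have PM X Y : P X -> P Y -> P (X *m Y).
  by move=> [u <-] [v <-]; exists (u * v)%g; rewrite fM.
have Pa : root_in P (short_a al al).
  by move=> l; exists (xroot R HB22 ia l); rewrite fa Va_root.
have Pb : root_in P (short_b be be).
  by move=> l; exists (xroot R HB22 ib l); rewrite fb Vb_root.
have Pc : root_in P (bunit 3 1 1%:M).
  by move=> l; exists (xroot R HB22 ic l); rewrite fc Vc_root.
exists al, be, f; split=> //; split=> // B Bs.
  exact: (upper_all nz2 PM alU beU al_be be_al als bes Pa Pb Pc Bs).
exact: (lower_all nz2 PM alU beU al_be be_al als bes Pa Pb Pc Bs).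
Qed.
End Realization.

Theorem theoremB (R : realType) (p k r : nat) (F : finFieldType)
    (p_prime : prime p) (p_gt2 : (2 < p)%N)
    (k_prime : prime k) (k_gt3 : (3 < k)%N) (p_neq_k : p != k)
    (r_ge1 : (1 <= r)%N) (q_gt3 : (3 < p ^ r)%N) (cardF : #|F| = (p ^ r)%N) :
  exists (Ma Mb Mc Ma' Mb' Mc' : 'M[F]_k)
      (Phi : {multiplicative Uplus R HB22 F -> SL F ((k + k) + (k + k))})
      (Phi' : {multiplicative Uplus R HB22 F -> Sp F (k + k)}),
    [/\ Ma \in unitmx, Mb \in unitmx & Mc \in unitmx]
    /\ [/\ Ma' \in unitmx, Mb' \in unitmx & Mc' \in unitmx]
    /\ [/\ Ma'^T = Ma', Mb'^T = Mb' & Mc'^T = Mc']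
    /\ is_Phi Ma Mb Mc (@SLval F ((k + k) + (k + k))) Phi
    /\ (forall y : SL F ((k + k) + (k + k)), exists u, Phi u = y)
    /\ is_Phi Ma' Mb' Mc' (@Spval F (k + k)) Phi'
    /\ (forall y : Sp F (k + k), exists u, Phi' u = y).
Proof.
have nz2 : 2%:R != 0 :> F := two_neq0 p_prime p_gt2 cardF.
case: k k_prime k_gt3 p_neq_k => [|[|[|n]]] // _ _ _.
have [Ma [Mb [f [[MaU MbU _ _] [f1 fM fV fU fL]]]]] :=
  Phi_unipotent_blocks R n false nz2.
have [Ma' [Mb' [g [[MaU' MbU' Mas Mbs] [g1 gM gV gU gL]]]]] :=
  Phi_unipotent_blocks R n true nz2.
have fdet u : \det (f u) == 1.
  apply/eqP; elim/Uplus_ind: u => [|x y dx dy|i l].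
  - by rewrite f1 det1.
  - by rewrite fM det_mulmx dx dy mulr1.
  - have [Ea Eb Ec] := fV l; case: i => -[|[|[|]]] //= lti.
    + by rewrite (_ : Ordinal lti = ia) ?Ea ?det_Va //; apply: val_inj.
    + by rewrite (_ : Ordinal lti = ib) ?Eb ?det_Vb //; apply: val_inj.
    + by rewrite (_ : Ordinal lti = ic) ?Ec ?det_Vc //; apply: val_inj.
have gsymp u : symplectic (g u).
  elim/Uplus_ind: u => [|x y dx dy|i l].
  - by rewrite g1 /symplectic trmx1 mul1mx mulmx1.
  - by rewrite gM; apply: symplecticM.
  - have [Ea Eb Ec] := gV l; case: i => -[|[|[|]]] //= lti.
    + rewrite (_ : Ordinal lti = ia) ?Ea; last exact: val_inj.
      by apply: symplectic_Va; apply: Mas.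
    + rewrite (_ : Ordinal lti = ib) ?Eb; last exact: val_inj.
      by apply: symplectic_Vb; apply: Mbs.
    + rewrite (_ : Ordinal lti = ic) ?Ec; last exact: val_inj.
      by apply: symplectic_Vc; rewrite trmx1.
have gSp u : (g u \in unitmx) && ((g u)^T *m Omega F _ *m g u == Omega F _).
  rewrite (introT eqP (gsymp u)) andbT.
  have gV1 : g u *m g u^-1%g = 1%:M by rewrite -gM mulgV.
  by case/mulmx1_unit: gV1.
pose Phi0 u := MkSL (fdet u); pose Phi0' u := MkSp (gSp u).
have PhiM : {morph Phi0 : x y / (x * y)%g} by move=> x y; apply: val_inj;
  apply: fM.
have PhiM' : {morph Phi0' : x y / (x * y)%g} by move=> x y; apply: val_inj;
  apply: gM.
pose Phi : {multiplicative Uplus R HB22 F -> SL F _} :=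
  HB.pack Phi0 (isMultiplicative.Build _ _ Phi0 PhiM).
pose Phi' : {multiplicative Uplus R HB22 F -> Sp F _} :=
  HB.pack Phi0' (isMultiplicative.Build _ _ Phi0' PhiM').
exists Ma, Mb, 1%:M, Ma', Mb', 1%:M, Phi, Phi'.
split; first by rewrite unitmx1.
split; first by rewrite unitmx1.
split; first by rewrite trmx1 Mas ?Mbs.
split; first exact: fV.
split.
  case=> X dX.
  have [u fu] : exists u, f u = X.
    apply: (SL_block_generated (P := fun X => exists u, f u = X)).
    - by move=> Y Z [u <-] [v <-]; exists (u * v)%g; rewrite fM.
    - by move=> B; apply: fU.
    - by move=> B; apply: fL.
    - exact/eqP.
  by exists u; apply: val_inj.
split; first exact: gV.
case=> X HX.
have [u gu] : exists u, g u = X.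
  apply: (Sp_block_generated (P := fun X => exists u, g u = X)).
  - by move=> Y Z [u <-] [v <-]; exists (u * v)%g; rewrite gM.
  - by move=> B BT; apply: gU.
  - by move=> B BT; apply: gL.
  - by case/andP: HX => _ /eqP.
by exists u; apply: val_inj.
Qed.
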